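(* Let (H1) (stated in the context) hold. For given $\varphi\in L^2_{\mathcal F}[0,T]$, the open-loop game described in the context admits a saddle point $\widehat u\equiv(\widehat u_1,\widehat u_2)$ if and only if $$\Theta_{11}\ge 0,\qquad \Theta_{22}\le 0,\qquad \Theta_1\varphi\in\mathcal R(\Theta),$$ where $\mathcal R(\Theta)$ is the range of $\Theta$. In this case, any saddle point $\widehat u$ is a solution of the equation $\Theta u+\Theta_1\varphi=0$, and it admits the representation $$\widehat u=-\Theta^{\dagger}\Theta_1\varphi+(I-\Theta^{\dagger}\Theta)v$$ for some $v\in L^2_{\mathcal F}[0,T]\times L^2_{\mathcal F}[0,T]$. In addition, the saddle point is unique if and only if $\mathcal N(\Theta)=\{0\}$, where $\mathcal N(\Theta)$ is the kernel of $\Theta$.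
   Context: Let $T>0$, $W$ a scalar Brownian motion on $(\Omega,\mathcal F,P)$, $(\mathcal F_t)$ its natural filtration, with $\mathcal F_0$ containing all null sets. $L^2(\Omega)$ is the space of $\mathcal F_T$-measurable real square-integrable random variables, with inner product $\langle\cdot,\cdot\rangle_1$; $L^2_{\mathcal F}[0,T]$ is the Hilbert space of real adapted processes $X$ with $E\int_0^T|X(t)|^2dt<\infty$, with inner product $\langle\cdot,\cdot\rangle_2$ (same notation for pairs). (H1): $A_1,B_1,C_1\in L^\infty(0,T;L^2_{\mathbb F}[0,T])$ and $A_2,B_2,C_2\in L^\infty(0,T;L^\infty_{\mathbb F}[0,T])$. Here $L^\infty(0,T;L^2_{\mathbb F}[0,T])$ is the set of real random kernels $k(t,s)$ with $k(t,\cdot)$ adapted for almost all $t$ and $\sup_{t\in[0,T]}E\int_0^T|k(t,s)|^2ds<\infty$, and $L^\infty(0,T;L^\infty_{\mathbb F}[0,T])$ is the set of those with $|k(t,s,\omega)|$ bounded in $(t,s,\omega)$. State equation, for $u=(u_1,u_2)^T\in L^2_{\mathcal F}[0,T]\times L^2_{\mathcal F}[0,T]$ (also used at $t=T$ to give $X(T)$): $$X(t)=\varphi(t)+\int_0^t[A_1(t,s)X(s)+B_1(t,s)u_1(s)+C_1(t,s)u_2(s)]ds+\int_0^t[A_2(t,s)X(s)+B_2(t,s)u_1(s)+C_2(t,s)u_2(s)]dW(s).$$ Cost: $J(u_1,u_2)=E\int_0^T[Q X^2+2X\,S\cdot u+Ru\cdot u]dt+E[GX(T)^2]$, where $S=(S_1,S_2)^T$,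 $R=(R_{ij})_{i,j=1,2}$, the $Q,S_i,R_{ij}$ are bounded adapted real processes and $G$ is a bounded random variable. $(\widehat u_1,\widehat u_2)$ is an (open-loop) saddle point if $J(\widehat u_1,u_2)\le J(\widehat u_1,\widehat u_2)\le J(u_1,\widehat u_2)$ for all $u_1,u_2\in L^2_{\mathcal F}[0,T]$. Operators. On $L^2_{\mathcal F}[0,T]$: $(\mathcal AX)(t)=\int_0^tA_1(t,s)X(s)ds+\int_0^tA_2(t,s)X(s)dW(s)$; $\mathcal B_1$ and $\mathcal C_1$ are defined likewise with $(B_1,B_2)$ and $(C_1,C_2)$. From $L^2_{\mathcal F}[0,T]$ to $L^2(\Omega)$: $\Delta_TX=\int_0^TA_1(T,s)X(s)ds+\int_0^TA_2(T,s)X(s)dW(s)$; $\Lambda_T$ and $\Pi_T$ are defined likewise with $(B_1,B_2)$ and $(C_1,C_2)$. The source asserts that under (H1) all these operators are bounded and that $I-\mathcal A$ has a bounded inverse. Put $\mathcal Uu=\mathcal B_1u_1+\mathcal C_1u_2$, $\Gamma_Tu=\Lambda_Tu_1+\Pi_Tu_2$. The operators $\mathcal Q,\mathcal S=(\mathcal S_1,\mathcal S_2)^T,\mathcal R=(\mathcal R_{ij})$ are those given by $$\langle\mathcal QX,X\rangle_2=E\int_0^TQX^2dt,\quad \langle\mathcal S X,u\rangle_2=E\int_0^TSX\cdot u\,dt,\quad \langle\mathcal Ru,u\rangle_2=E\int_0^TRu\cdot u\,dt,$$ $$\langle\mathcal S_iX,u_i\rangle_2=E\int_0^TS_iXu_i\,dt,\quad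 \langle\mathcal R_{ij}u_i,u_j\rangle_2=E\int_0^TR_{ij}u_iu_j\,dt,$$ and $G$ acts by multiplication. A star denotes the Hilbert-space adjoint. Put $$\mathcal Q'=\mathcal Q+\Delta_T^*G\Delta_T,\quad \mathcal S'=\mathcal S+\Gamma_T^*G\Delta_T,\quad \mathcal R'=\mathcal R+\Gamma_T^*G\Gamma_T,$$ $$\Theta=\big(\mathcal U^*(I-\mathcal A^* )^{-1}\mathcal Q'+\mathcal S'\big)(I-\mathcal A)^{-1}\mathcal U+\mathcal U^*(I-\mathcal A^* )^{-1}\mathcal S'^*+\mathcal R',$$ $$\Theta_1\varphi=\big(\mathcal U^*(I-\mathcal A^* )^{-1}\mathcal Q'+\mathcal S'\big)(I-\mathcal A)^{-1}\varphi+\mathcal U^*(I-\mathcal A^* )^{-1}\Delta_T^*G\varphi(T)+\Gamma_T^*G\varphi(T).$$ Write $\Theta=(\Theta_{ij})_{i,j=1,2}$ in block form; explicitly $$\Theta_{11}=\mathcal B_1^*(I-\mathcal A^* )^{-1}\mathcal Q'(I-\mathcal A)^{-1}\mathcal B_1+\mathcal S_1(I-\mathcal A)^{-1}\mathcal B_1+\Lambda_T^*G\Delta_T(I-\mathcal A)^{-1}\mathcal B_1+\mathcal B_1^*(I-\mathcal A^* )^{-1}(\mathcal S_1^*+\Delta_T^*G\Lambda_T)+\mathcal R_{11}+\Lambda_T^*G\Lambda_T,$$ $$\Theta_{22}=\mathcal C_1^*(I-\mathcal A^* )^{-1}\mathcal Q'(I-\mathcal A)^{-1}\mathcal C_1+\mathcal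 S_2(I-\mathcal A)^{-1}\mathcal C_1+\Pi_T^*G\Delta_T(I-\mathcal A)^{-1}\mathcal C_1+\mathcal C_1^*(I-\mathcal A^* )^{-1}(\mathcal S_2^*+\Delta_T^*G\Pi_T)+\mathcal R_{22}+\Pi_T^*G\Pi_T.$$ $\Theta_{ii}\ge0$ (resp. $\le 0$) means $\langle\Theta_{ii}w,w\rangle_2\ge0$ (resp. $\le0$) for all $w\in L^2_{\mathcal F}[0,T]$. Pseudo-inverse of a self-adjoint operator $\Theta$ on a Hilbert space $\mathcal H$: under $\mathcal H=\mathcal N(\Theta)\oplus\overline{\mathcal R(\Theta)}$ one has $\Theta=\mathrm{diag}(0,\widehat\Theta)$ with $\widehat\Theta$ self-adjoint on $\overline{\mathcal R(\Theta)}$, and $\Theta^\dagger=\mathrm{diag}(0,\widehat\Theta^{-1})$ with domain $\mathcal N(\Theta)+\mathcal R(\Theta)$.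
   Formalization: That the operators A, B_1, C_1, Delta_T, Lambda_T, Pi_T exist and are bounded and that I-A has a bounded inverse is assumed in addition to (H1), since (H1) alone does not imply it (random A_1 can send X out of L^2_F); phi(T) is assumed square-integrable. *)

(* Defs.v *)
From HB Require Import structures.
From mathcomp Require Import all_boot all_order all_algebra generic_quotient.
From mathcomp Require Import all_classical all_reals all_analysis measurable_realfun.
From mathcomp Require Import ring lra.

Set Implicit Arguments.
Unset Strict Implicit.
Unset Printing Implicit Defensive.

Import Order.TTheory GRing.Theory Num.Theory.
Import numFieldNormedType.Exports.

Local Open Scope classical_set_scope.
Local Open Scope ring_scope.

HB.mixin Record isInnerProduct (R : realType) V & GRing.Lmodule R V := {
  dotp : V -> V -> R ;
  dotpC : forall x y, dotp x y = dotp y x ;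
  dotpDl : forall x y z, dotp (x + y) z = dotp x z + dotp y z ;
  dotpZl : forall a x y, dotp (a *: x) y = a * dotp x y ;
  dotp_ge0 : forall x, 0 <= dotp x x ;
  dotp_eq0 : forall x, dotp x x = 0 -> x = 0
}.

#[short(type=innerProductType)]
HB.structure Definition InnerProduct (R : realType) :=
  {V of GRing.Lmodule R V & isInnerProduct R V}.

Definition hnorm (R : realType) (V : innerProductType R) (x : V) : R :=
  Num.sqrt (dotp x x).

Section ProductInner.
Context (R : realType) (U V : innerProductType R).
Implicit Types x y z : (U * V)%type.

Let pdot x y : R := dotp x.1 y.1 + dotp x.2 y.2.
Let pdotC x y : pdot x y = pdot y x.
Proof. by rewrite /pdot dotpC [X in _ + X]dotpC. Qed.
Let pdotDl x y z : pdot (x + y) z = pdot x z + pdot y z.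
Proof. by rewrite /pdot /= !dotpDl addrACA. Qed.
Let pdotZl a x y : pdot (a *: x) y = a * pdot x y.
Proof. by rewrite /pdot /= !dotpZl mulrDr. Qed.
Let pdot_ge0 x : 0 <= pdot x x.
Proof. by rewrite /pdot addr_ge0 ?dotp_ge0. Qed.
Let pdot_eq0 x : pdot x x = 0 -> x = 0.
Proof.
move/eqP; rewrite paddr_eq0 ?dotp_ge0// => /andP[/eqP/dotp_eq0 h1 /eqP/dotp_eq0].
by case: x h1 => [x1 x2] /= -> ->.
Qed.

HB.instance Definition _ := isInnerProduct.Build R (U * V)%type
  pdotC pdotDl pdotZl pdot_ge0 pdot_eq0.
End ProductInner.

Section Operators.
Context (R : realType).
Implicit Types H K : innerProductType R.

Definition bounded_operator H K (L : H -> K) : Prop :=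
  (forall (a : R) x y, L (a *: x + y) = a *: L x + L y) /\
  (exists C : R, forall x, hnorm (L x) <= C * hnorm x).

Definition has_bounded_inverse H (L : H -> H) : Prop :=
  exists M : H -> H, [/\ bounded_operator M, cancel L M & cancel M L].

Definition inverse H (L : H -> H) : H -> H :=
  xget (fun=> 0) [set M : H -> H | cancel L M /\ cancel M L].

Definition adjoint H K (L : H -> K) : K -> H :=
  xget (fun=> 0) [set M : K -> H | forall x y, dotp (L x) y = dotp x (M y)].

(* The operator M determined by <M x, y> = b x y. *)
Definition operator_of_form H K (b : H -> K -> R) : H -> K :=
  xget (fun=> 0) [set M : H -> K | forall x y, dotp (M x) y = b x y].

(* The self-adjoint operator M determined by <M x, x> = q x. A quadratic form
   leaves the antisymmetric part of an operator free, whence the symmetry. *)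
Definition operator_of_quadratic H (q : H -> R) : H -> H :=
  xget (fun=> 0) [set M : H -> H |
    (forall x y, dotp (M x) y = dotp x (M y)) /\ (forall x, dotp (M x) x = q x)].

Definition null_space H K (L : H -> K) : set H := [set x | L x = 0].

Definition hclosure H (A : set H) : set H :=
  [set x | forall e : R, 0 < e -> exists2 y, A y & hnorm (x - y) < e].

(* For M self-adjoint and x = n + M y with n in the kernel of M and y in the
   closure of its range, the value is y; it is 0 off the domain
   null_space M + range M. *)
Definition pseudo_inverse H (M : H -> H) (x : H) : H :=
  xget 0 [set y | hclosure (range M) y /\ exists2 n, null_space M n & x = n + M y].

End Operators.

Record semi_inner (R : realType) (V : lmodType R) := SemiInner {
  sform :> V -> V -> R ;
  sformC : forall x y, sform x y = sform y x ;
  sformDl : forall x y z, sform (x + y) z = sform x z + sform y z ;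
  sformZl : forall a x y, sform (a *: x) y = a * sform x y ;
  sform_ge0 : forall x, 0 <= sform x x
}.

Section SeparatedQuotient.
Context (R : realType) (V : lmodType R) (f : semi_inner V).
Local Open Scope quotient_scope.

Let fDr x y z : f x (y + z) = f x y + f x z.
Proof. by rewrite sformC sformDl !(sformC f x). Qed.
Let fZr a x y : f x (a *: y) = a * f x y.
Proof. by rewrite sformC sformZl (sformC f x). Qed.
Let fNl x y : f (- x) y = - f x y.
Proof. by rewrite -scaleN1r sformZl mulN1r. Qed.

Let null_form x y : f x x = 0 -> f x y = 0.
Proof.
move=> x0; apply: contrapT => /eqP xy0.
have := sform_ge0 f (y + (- (f y y + 1) / (2 * f x y)) *: x).
rewrite !(sformDl, fDr, sformZl, fZr) x0 (sformC f y x).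
have -> : - (f y y + 1) / (2 * f x y) * f x y = - (f y y + 1) / 2 by field.
by lra.
Qed.

Definition null_rel : rel V := fun x y => f (x - y) (x - y) == 0.

Let null_relP x y : null_rel x y <-> forall z, f x z = f y z.
Proof.
split=> [/eqP h z|h].
  by have := null_form z h; rewrite sformDl fNl => /eqP; rewrite subr_eq0 => /eqP.
by apply/eqP; rewrite sformDl fNl h subrr.
Qed.

Let null_rel_refl : reflexive null_rel.
Proof. by move=> x; apply/null_relP. Qed.
Let null_rel_sym : symmetric null_rel.
Proof. by move=> x y; apply/idP/idP => /null_relP h; apply/null_relP => z. Qed.
Let null_rel_trans : transitive null_rel.
Proof.
by move=> y x z /null_relP h1 /null_relP h2; apply/null_relP => t; rewrite h1.
Qed.

Canonical null_equiv :=
  EquivRel null_rel null_rel_refl null_rel_sym null_rel_trans.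

Definition separated : Type := {eq_quot null_rel}.
HB.instance Definition _ := Choice.on separated.
HB.instance Definition _ := EqQuotient.on separated.

Implicit Types a b c : separated.

Let pi_eq x y : (\pi_separated x = \pi_separated y) <-> (forall z, f x z = f y z).
Proof.
split=> [/eqP|h]; first by rewrite eqmodE => /null_relP.
by apply/eqP; rewrite eqmodE; apply/null_relP.
Qed.

Let repr_pi x z : f (repr (\pi_separated x)) z = f x z.
Proof. by move: z; apply/pi_eq; rewrite reprK. Qed.

Definition sep_zero : separated := \pi_separated 0.
Definition sep_opp a : separated := \pi_separated (- repr a).
Definition sep_add a b : separated := \pi_separated (repr a + repr b).
Definition sep_scale (k : R) a : separated := \pi_separated (k *: repr a).
Definition sep_dot a b : R := f (repr a) (repr b).

Let sep_eq a b : (forall z, f (repr a) z = f (repr b) z) -> a = b.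
Proof. by move=> h; rewrite -[a]reprK -[b]reprK; apply/pi_eq. Qed.

Let rule := (repr_pi, sformDl, sformZl, fNl).

Let sep_addA : associative sep_add.
Proof. by move=> a b c; apply: sep_eq => z; rewrite !rule addrA. Qed.
Let sep_addC : commutative sep_add.
Proof. by move=> a b; apply: sep_eq => z; rewrite !rule addrC. Qed.
Let f0l z : f 0 z = 0.
Proof. by rewrite -(scale0r (0 : V)) sformZl mul0r. Qed.
Let sep_add0 : left_id sep_zero sep_add.
Proof. by move=> a; apply: sep_eq => z; rewrite !rule f0l add0r. Qed.
Let sep_addN : left_inverse sep_zero sep_opp sep_add.
Proof. by move=> a; apply: sep_eq => z; rewrite !rule f0l addNr. Qed.

HB.instance Definition _ :=
  GRing.isZmodule.Build separated sep_addA sep_addC sep_add0 sep_addN.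

Let sep_scaleA (k l : R) a :
  sep_scale k (sep_scale l a) = sep_scale (k * l) a.
Proof. by apply: sep_eq => z; rewrite !rule mulrA. Qed.
Let sep_scale1 : left_id 1 sep_scale.
Proof. by move=> a; apply: sep_eq => z; rewrite !rule mul1r. Qed.
Let sep_scaleDr : right_distributive sep_scale +%R.
Proof.
move=> k a b; apply: sep_eq => z.
by rewrite [in RHS]/GRing.add [in LHS]/GRing.add /= !rule mulrDr.
Qed.
Let sep_scaleDl a : {morph sep_scale^~ a : k l / k + l}.
Proof.
move=> k l; apply: sep_eq => z.
by rewrite [X in _ = f (repr X) _]/GRing.add /= !rule mulrDl.
Qed.

HB.instance Definition _ := GRing.Zmodule_isLmodule.Build R separated
  sep_scaleA sep_scale1 sep_scaleDr sep_scaleDl.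

Let sep_dotC a b : sep_dot a b = sep_dot b a.
Proof. exact: sformC. Qed.
Let sep_dotDl a b c : sep_dot (a + b) c = sep_dot a c + sep_dot b c.
Proof. by rewrite /sep_dot repr_pi sformDl. Qed.
Let sep_dotZl (k : R) a b : sep_dot (k *: a) b = k * sep_dot a b.
Proof. by rewrite /sep_dot repr_pi sformZl. Qed.
Let sep_dot_ge0 a : 0 <= sep_dot a a.
Proof. exact: sform_ge0. Qed.
Let sep_dot_eq0 a : sep_dot a a = 0 -> a = 0.
Proof.
by move=> /null_form h; apply: sep_eq => z; rewrite h repr_pi f0l.
Qed.

HB.instance Definition _ := isInnerProduct.Build R separated
  sep_dotC sep_dotDl sep_dotZl sep_dot_ge0 sep_dot_eq0.

End SeparatedQuotient.

Section L2space.
Context d (X : measurableType d) (R : realType) (mu : {measure set X -> \bar R}).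
Context (D : set X) (mD : measurable D).
Context (S : submodClosed (X -> R)).

Definition square_integrable (f : X -> R) : Prop :=
  measurable_fun D f /\ (\int[mu]_(x in D) (f x ^+ 2)%:E < +oo)%E.

Definition L2fun : {pred X -> R} :=
  fun f => (f \in S) && `[< square_integrable f >].

Let sqr_integrable (f : X -> R) : measurable_fun D f ->
  (\int[mu]_(x in D) (f x ^+ 2)%:E < +oo)%E ->
  mu.-integrable D (fun x => (f x ^+ 2)%:E).
Proof.
move=> mf fo; apply/integrableP; split.
  by apply/measurable_EFinP; exact: measurable_funX.
rewrite (_ : integral _ _ _ = \int[mu]_(x in D) (f x ^+ 2)%:E)%E//.
by apply: eq_integral => x _; rewrite gee0_abs// lee_fin sqr_ge0.
Qed.

Lemma mul_integrable (f g : X -> R) : square_integrable f -> square_integrable g ->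
  mu.-integrable D (fun x => (f x * g x)%:E).
Proof.
move=> [mf fo] [mg go].
apply: (@le_integrable _ _ _ mu D mD _ (fun x => (f x ^+ 2 + g x ^+ 2)%:E)).
- by apply/measurable_EFinP; exact: measurable_funM.
- move=> x _; rewrite !abse_EFin lee_fin normrM.
  rewrite [leRHS]ger0_norm ?addr_ge0 ?sqr_ge0//.
  rewrite -(real_normK (num_real (f x))) -(real_normK (num_real (g x))).
  by have := sqr_ge0 (`|f x| - `|g x|); have := sqr_ge0 (`|f x| + `|g x|); nra.
- rewrite (_ : (fun x => _) =
    ((fun x => (f x ^+ 2)%:E) \+ (fun x => (g x ^+ 2)%:E))%E)//.
  by apply: integrableD => //; exact: sqr_integrable.
Qed.

Let L2funE f : (f \in L2fun) = (f \in S) && `[< square_integrable f >].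
Proof. by []. Qed.

Lemma L2fun_submod : submod_closed L2fun.
Proof.
split=> [|a f g].
  rewrite L2funE rpred0/=; apply/asboolP; split.
    exact: measurable_cst.
  by rewrite integral0_eq// => x _; rewrite /= expr0n.
rewrite !L2funE => /andP[Sf /asboolP [mf fo]] /andP[Sg /asboolP[mg go]].
rewrite rpredD ?rpredZ//=; apply/asboolP.
have mh : measurable_fun D (a *: f + g).
  by apply: measurable_funD => //; exact: measurable_funM.
split => //.
have i1 := @mul_integrable f g (conj mf fo) (conj mg go).
have i2 := sqr_integrable mf fo.
have i3 := sqr_integrable mg go.
rewrite [ltLHS](_ : _ = \int[mu]_(x in D) ((a ^+ 2)%:E * (f x ^+ 2)%:E
    + ((a *+ 2)%:E * (f x * g x)%:E + (g x ^+ 2)%:E)))%E; last first.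
  apply: eq_integral => x _; rewrite -!EFinM -!EFinD; congr EFin.
  rewrite [LHS](_ : _ = (a * f x + g x) ^+ 2)//; ring.
have i4 : mu.-integrable D (fun x => ((a ^+ 2)%:E * (f x ^+ 2)%:E
    + ((a *+ 2)%:E * (f x * g x)%:E + (g x ^+ 2)%:E)))%E.
  apply: integrableD => //; first exact: integrableZl.
  by apply: integrableD => //; exact: integrableZl.
have := integrable_fin_num mD i4.
by rewrite fin_num_abs => /(le_lt_trans (lee_abs _)).
Qed.

HB.instance Definition _ := GRing.isSubmodClosed.Build R (X -> R) L2fun L2fun_submod.

Definition L2sub : Type := {f : X -> R | f \in L2fun}.
HB.instance Definition _ := SubChoice.on L2sub.
HB.instance Definition _ := [SubChoice_isSubLmodule of L2sub by <:].

Let form (f g : L2sub) : R := Rintegral mu D (fun x => val f x * val g x).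

Let L2subP (f : L2sub) : square_integrable (val f).
Proof. by case: f => f /= /andP[_ /asboolP]. Qed.

Let formC f g : form f g = form g f.
Proof. by rewrite /form; congr Rintegral; apply/funext => x; rewrite mulrC. Qed.
Let formDl f g h : form (f + g) h = form f h + form g h.
Proof.
rewrite /form -RintegralD//; [|exact: mul_integrable..].
by congr Rintegral; apply/funext => x; rewrite raddfD/= mulrDl.
Qed.
Let formZl a f g : form (a *: f) g = a * form f g.
Proof.
rewrite /form -RintegralZl//; last exact: mul_integrable.
by congr Rintegral; apply/funext => x; rewrite linearZ/= mulrA.
Qed.
Let form_ge0 f : 0 <= form f f.
Proof. by apply: Rintegral_ge0 => x _; exact: sqr_ge0. Qed.

Definition L2semi : semi_inner L2sub := SemiInner formC formDl formZl form_ge0.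

Definition L2space : innerProductType R := separated L2semi.

Definition L2val (x : L2space) : X -> R := val (repr (x : separated L2semi)).

Definition L2class (f : X -> R) (hf : f \in L2fun) : L2space :=
  (\pi_(separated L2semi) (exist _ f hf : L2sub))%qT.

End L2space.

Section Stochastic.
Context d (Omega : measurableType d) (R : realType) (P : probability Omega R).
Context (T : R) (W : R -> {RV P >-> R}).

Local Notation space := (measurableTypeR R * Omega)%type.

(* The sigma-algebra generated by the W s, s <= t, and the P-null sets. *)
Definition natural_filtration (t : R) : set (set Omega) :=
  <<s [set A | (exists s B, [/\ 0 <= s <= t, measurable B & A = W s @^-1` B]) \/
               (measurable A /\ P A = 0%E)] >>.

Definition measurable_wrt (F : set (set Omega)) (f : Omega -> R) : Prop :=
  forall B, measurable B -> F (f @^-1` B).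

Definition increment (s t : R) (w : Omega) : R := W t w - W s w.

Definition brownian_motion : Prop :=
  [/\ {ae P, forall w, W 0 w = 0},
      {ae P, forall w, {within `[0, T], continuous (fun t => W t w)}},
      forall s t (B : set R), 0 <= s -> s < t -> t <= T -> measurable B ->
        P (increment s t @^-1` B) = normal_prob 0 (Num.sqrt (t - s)) B &
      forall s t (A : set Omega) (B : set R), 0 <= s -> s < t -> t <= T ->
        <<s [set C | exists r D,
               [/\ 0 <= r <= s, measurable D & C = W r @^-1` D]] >> A ->
        measurable B ->
        (P (A `&` increment s t @^-1` B) = P A * P (increment s t @^-1` B))%E].

(* Processes are functions on R * Omega; only their values at times in [0, T]
   (here [0, t]) are relevant. *)
Definition time_domain (t : R) : set space := `[0, t] `*` setT.

Definition space_time : {measure set space -> \bar R} :=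
  (lebesgue_measure \x P)%E.

Definition adapted (t : R) (X : space -> R) : Prop :=
  forall s, 0 <= s <= t ->
    measurable_wrt (natural_filtration s) (fun w => X (s, w)).

Definition adapted_process (t : R) (X : space -> R) : Prop :=
  measurable_fun (time_domain t) X /\ adapted t X.

(* The integrand  sum_i xi_i 1_(a_i, b_i]. *)
Record simple_process := SimpleProcess {
  sp_size : nat ;
  sp_left : 'I_sp_size -> R ;
  sp_right : 'I_sp_size -> R ;
  sp_coef : 'I_sp_size -> Omega -> R
}.

Definition simple_on (t : R) (H : simple_process) : Prop :=
  forall i : 'I_(sp_size H),
    [/\ 0 <= sp_left i, sp_left i <= sp_right i, sp_right i <= t,
        measurable_wrt (natural_filtration (sp_left i)) (sp_coef i) &
        exists M : R, forall w, `|sp_coef i w| <= M].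

Definition simple_val (H : simple_process) (z : space) : R :=
  \sum_(i < sp_size H)
    sp_coef i z.2 * ((sp_left i < z.1) && (z.1 <= sp_right i))%:R.

Definition simple_integral (H : simple_process) (w : Omega) : R :=
  \sum_(i < sp_size H) sp_coef i w * increment (sp_left i) (sp_right i) w.

(* I is a version of the Ito integral of sigma against W over [0, t]. *)
Definition is_ito_integral (t : R) (sigma : space -> R) (I : Omega -> R) :
  Prop :=
  [/\ adapted_process t sigma, measurable_fun setT I &
      exists H : nat -> simple_process,
        [/\ forall n, simple_on t (H n),
            (\int[space_time]_(z in time_domain t)
               ((simple_val (H n) z - sigma z) ^+ 2)%:E)%E
              @[n --> \oo] --> 0%E &
            (\int[P]_w ((simple_integral (H n) w - I w) ^+ 2)%:E)%E
              @[n --> \oo] --> 0%E]].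

(* y = y0 + int_0^t b ds + int_0^t sigma dW  almost surely. *)
Definition ito_value (t : R) (y0 : Omega -> R) (b sigma : space -> R)
    (y : Omega -> R) : Prop :=
  exists2 I : Omega -> R, is_ito_integral t sigma I &
    {ae P, forall w,
      y w = y0 w + Rintegral lebesgue_measure `[0, t] (fun s => b (s, w)) + I w}.

Lemma measurable_wrt_submod (F : set (set Omega)) : sigma_algebra setT F ->
  submod_closed (fun f : Omega -> R => `[< measurable_wrt F f >]).
Proof.
move=> sF.
have eqF A : <<s F >> A = F A.
  by rewrite (sigma_algebra_id sF).
have mP f : measurable_wrt F f <->
    measurable_fun setT (f : g_sigma_algebraType F -> R).
  split=> [h _ B mB|h B mB]; first by rewrite setTI; apply: sub_sigma_algebra; exact: h.
  by have := h measurableT B mB; rewrite setTI /measurable /= eqF.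
split=> [|a f g /asboolP/mP mf /asboolP/mP mg].
  by apply/asboolP/mP; exact: measurable_cst.
apply/asboolP/mP; apply: measurable_funD => //.
exact: measurable_funM.
Qed.

Definition final_measurable : {pred Omega -> R} :=
  fun f => `[< measurable_wrt (natural_filtration T) f >].

Let final_submod : submod_closed final_measurable.
Proof. exact: measurable_wrt_submod (smallest_sigma_algebra _ _). Qed.

HB.instance Definition _ :=
  GRing.isSubmodClosed.Build R (Omega -> R) final_measurable final_submod.

Definition adapted_fun : {pred space -> R} := fun X => `[< adapted T X >].

Let adapted_submod : submod_closed adapted_fun.
Proof.
have h s := measurable_wrt_submod (smallest_sigma_algebra _ _ : sigma_algebra setT (natural_filtration s)).
split=> [|a f g /asboolP mf /asboolP mg]; apply/asboolP => s s0.
  by have [/asboolP] := h s.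
by have [_ /(_ a _ _ (asboolT (mf s s0)) (asboolT (mg s s0)))/asboolP] := h s.
Qed.

HB.instance Definition _ :=
  GRing.isSubmodClosed.Build R (space -> R) adapted_fun adapted_submod.

Lemma measurable_time_domain : measurable (time_domain T).
Proof. by apply: measurableX. Qed.

Definition L2F : innerProductType R :=
  L2space space_time measurable_time_domain adapted_fun.

Definition L2Omega : innerProductType R :=
  L2space P measurableT final_measurable.

End Stochastic.

Record game (R : realType) (Omega : Type) := Game {
  kA1 : R -> R * Omega -> R ; kA2 : R -> R * Omega -> R ;
  kB1 : R -> R * Omega -> R ; kB2 : R -> R * Omega -> R ;
  kC1 : R -> R * Omega -> R ; kC2 : R -> R * Omega -> R ;
  wQ : R * Omega -> R ;
  wS1 : R * Omega -> R ; wS2 : R * Omega -> R ;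
  wR11 : R * Omega -> R ; wR12 : R * Omega -> R ;
  wR21 : R * Omega -> R ; wR22 : R * Omega -> R ;
  wG : Omega -> R
}.

Section Game.
Context d (Omega : measurableType d) (R : realType) (P : probability Omega R).
Context (T : R) (W : R -> {RV P >-> R}).

Local Notation space := (measurableTypeR R * Omega)%type.
Local Notation HF := (L2F T W).
Local Notation HO := (L2Omega T W).

Definition random_kernel (k : R -> space -> R) : Prop :=
  measurable_fun (`[0, T] `*` time_domain T) (fun z : measurableTypeR R * space => k z.1 z.2) /\
  {ae lebesgue_measure, forall t : R, 0 <= t <= T -> adapted W T (k t)}.

Definition kernel_L2 (k : R -> space -> R) : Prop :=
  random_kernel k /\
  exists M : R, forall t, 0 <= t <= T ->
    (\int[space_time P]_(z in time_domain T) (k t z ^+ 2)%:E <= M%:E)%E.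

Definition kernel_bounded (k : R -> space -> R) : Prop :=
  random_kernel k /\
  exists M : R, forall t s w, 0 <= t <= T -> 0 <= s <= T -> `|k t (s, w)| <= M.

Definition bounded_adapted (X : space -> R) : Prop :=
  adapted_process W T X /\
  exists M : R, forall s w, 0 <= s <= T -> `|X (s, w)| <= M.

Definition bounded_variable (X : Omega -> R) : Prop :=
  measurable_fun setT X /\ exists M : R, forall w, `|X w| <= M.

Variable g : game R Omega.

Definition H1 : Prop :=
  [/\ kernel_L2 (kA1 g), kernel_L2 (kB1 g) & kernel_L2 (kC1 g)] /\
  [/\ kernel_bounded (kA2 g), kernel_bounded (kB2 g) & kernel_bounded (kC2 g)].

Definition bounded_weights : Prop :=
  [/\ bounded_adapted (wQ g), bounded_adapted (wS1 g) /\ bounded_adapted (wS2 g),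
      bounded_adapted (wR11 g) /\ bounded_adapted (wR12 g),
      bounded_adapted (wR21 g) /\ bounded_adapted (wR22 g) &
      bounded_variable (wG g)].

Definition drift (X u1 u2 : HF) (t : R) (z : space) : R :=
  kA1 g t z * L2val X z + kB1 g t z * L2val u1 z + kC1 g t z * L2val u2 z.

Definition diffusion (X u1 u2 : HF) (t : R) (z : space) : R :=
  kA2 g t z * L2val X z + kB2 g t z * L2val u1 z + kC2 g t z * L2val u2 z.

(* p.1 is the state process and p.2 its terminal value X(T). The latter is read
   off from the equation at t = T, since p.1 is a class of processes. *)
Definition is_state (phi : space -> R) (u : (HF * HF)%type)
    (p : (HF * HO)%type) : Prop :=
  {ae lebesgue_measure, forall t : R, 0 <= t <= T ->
    ito_value W t (fun w => phi (t, w))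
      (drift p.1 u.1 u.2 t) (diffusion p.1 u.1 u.2 t)
      (fun w => L2val p.1 (t, w))} /\
  ito_value W T (fun w => phi (T, w))
    (drift p.1 u.1 u.2 T) (diffusion p.1 u.1 u.2 T) (L2val p.2).

Definition expect_time (F : space -> R) : R :=
  Rintegral (space_time P) (time_domain T) F.

Definition formQ (X : HF) : R := expect_time (fun z => wQ g z * L2val X z ^+ 2).

Definition formS (X : HF) (u : (HF * HF)%type) : R :=
  expect_time (fun z => wS1 g z * L2val X z * L2val u.1 z +
                        wS2 g z * L2val X z * L2val u.2 z).

Definition formR (u : (HF * HF)%type) : R :=
  expect_time (fun z =>
    (wR11 g z * L2val u.1 z + wR12 g z * L2val u.2 z) * L2val u.1 z +
    (wR21 g z * L2val u.1 z + wR22 g z * L2val u.2 z) * L2val u.2 z).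

Definition formG (x y : HO) : R :=
  Rintegral P setT (fun w => wG g w * L2val x w * L2val y w).

Definition cost (phi : space -> R) (u : (HF * HF)%type) : R :=
  let p := xget (0, 0) [set p | is_state phi u p] in
  let X := L2val p.1 in
  let u1 := L2val u.1 in
  let u2 := L2val u.2 in
  expect_time (fun z =>
    wQ g z * X z ^+ 2 +
    2 * X z * (wS1 g z * u1 z + wS2 g z * u2 z) +
    ((wR11 g z * u1 z + wR12 g z * u2 z) * u1 z +
     (wR21 g z * u1 z + wR22 g z * u2 z) * u2 z)) +
  Rintegral P setT (fun w => wG g w * L2val p.2 w ^+ 2).

Definition saddle_point (phi : space -> R) (u : (HF * HF)%type) : Prop :=
  forall v1 v2 : HF,
    cost phi (u.1, v2) <= cost phi u /\ cost phi u <= cost phi (v1, u.2).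

Definition volterra_at (k1 k2 : R -> space -> R) (X : HF) (t : R)
    (y : Omega -> R) : Prop :=
  ito_value W t (fun=> 0) (fun z => k1 t z * L2val X z)
    (fun z => k2 t z * L2val X z) y.

Definition volterra_operator (k1 k2 : R -> space -> R) (L : HF -> HF) : Prop :=
  forall X, {ae lebesgue_measure, forall t : R, 0 <= t <= T ->
    volterra_at k1 k2 X t (fun w => L2val (L X) (t, w))}.

Definition terminal_operator (k1 k2 : R -> space -> R) (L : HF -> HO) : Prop :=
  forall X, volterra_at k1 k2 X T (L2val (L X)).

Record state_operators := StateOperators {
  opA : HF -> HF ; opB : HF -> HF ; opC : HF -> HF ;
  Delta_T : HF -> HO ; Lambda_T : HF -> HO ; Pi_T : HF -> HO
}.

Variable o : state_operators.

Definition operators_of_game : Prop :=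
  [/\ volterra_operator (kA1 g) (kA2 g) (opA o),
      volterra_operator (kB1 g) (kB2 g) (opB o) &
      volterra_operator (kC1 g) (kC2 g) (opC o)] /\
  [/\ terminal_operator (kA1 g) (kA2 g) (Delta_T o),
      terminal_operator (kB1 g) (kB2 g) (Lambda_T o) &
      terminal_operator (kC1 g) (kC2 g) (Pi_T o)].

Definition I_A (X : HF) : HF := X - opA o X.

Definition operators_bounded : Prop :=
  [/\ bounded_operator (opA o), bounded_operator (opB o) &
      bounded_operator (opC o)] /\
  [/\ bounded_operator (Delta_T o), bounded_operator (Lambda_T o) &
      bounded_operator (Pi_T o)] /\
  has_bounded_inverse I_A.

Definition I_Astar (X : HF) : HF := X - adjoint (opA o) X.

Definition opU (u : (HF * HF)%type) : HF := opB o u.1 + opC o u.2.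
Definition Gamma_T (u : (HF * HF)%type) : HO := Lambda_T o u.1 + Pi_T o u.2.

Definition opQ : HF -> HF := operator_of_quadratic formQ.
Definition opS : HF -> (HF * HF)%type := operator_of_form formS.
Definition opR : (HF * HF)%type -> (HF * HF)%type := operator_of_quadratic formR.
(* Multiplication by G, defined by <G x, y> = E[G x y] so that it maps L2Omega
   to itself even if G is not measurable for the filtration at time T. *)
Definition opG : HO -> HO := operator_of_form formG.

Definition opQ' (X : HF) : HF := opQ X + adjoint (Delta_T o) (opG (Delta_T o X)).
Definition opS' (X : HF) : (HF * HF)%type :=
  opS X + adjoint Gamma_T (opG (Delta_T o X)).
Definition opR' (u : (HF * HF)%type) : (HF * HF)%type :=
  opR u + adjoint Gamma_T (opG (Gamma_T u)).

(* U^* (I - A^* )^-1 *)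
Definition opUstar (X : HF) : (HF * HF)%type :=
  adjoint opU (inverse I_Astar X).

(* (U^* (I - A^* )^-1 Q' + S') (I - A)^-1 *)
Definition opV (X : HF) : (HF * HF)%type :=
  opUstar (opQ' (inverse I_A X)) + opS' (inverse I_A X).

Definition Theta (u : (HF * HF)%type) : (HF * HF)%type :=
  opV (opU u) + opUstar (adjoint opS' u) + opR' u.

Definition Theta11 (w : HF) : HF := (Theta (w, 0)).1.
Definition Theta22 (w : HF) : HF := (Theta (0, w)).2.

(* Theta_1 phi, the arguments being phi in L2F and phi(T) in L2Omega. *)
Definition Theta1 (phi : HF) (phiT : HO) : (HF * HF)%type :=
  opV phi + opUstar (adjoint (Delta_T o) (opG phiT)) + adjoint Gamma_T (opG phiT).

End Game.

(* Main.v *)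
Require Import Defs.
From HB Require Import structures.
From mathcomp Require Import all_boot all_order all_algebra generic_quotient.
From mathcomp Require Import all_classical all_reals all_analysis measurable_realfun.
From mathcomp Require Import ring lra.

Set Implicit Arguments.
Unset Strict Implicit.
Unset Printing Implicit Defensive.

Import Order.TTheory GRing.Theory Num.Theory.
Import numFieldNormedType.Exports.
Local Open Scope classical_set_scope.
Local Open Scope ring_scope.

(** The Ito isometry makes the Ito integral of a given integrand unique up to null sets, so the
    state equation says exactly X = phi + A X + U u and X(T) = phi(T) + Delta_T X + Gamma_T u; it
    has the unique solution X = (I - A)^-1 (phi + U u). Substituting it, the cost becomes
    J u = c + 2 <Theta_1 phi, u> + <Theta u, u> with Theta self-adjoint; the adjoints in Theta exist
    by the Riesz theorem, as the L2 spaces of adapted processes are complete. Varying one component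
    of u at a time, J has a saddle point at u iff Theta_11 >= 0, Theta_22 <= 0 and
    Theta u + Theta_1 phi = 0. For such a u the representation holds with v = u, since the
    pseudo-inverse is odd. *)

(** * Inner product spaces *)

(** [adjoint], [inverse], [operator_of_form] and the state inside [cost] are chosen by [xget], with
    a default when no candidate exists. Each is therefore reached only through its characteristic
    identity, once existence is shown (for the state, also uniqueness). The computation is carried
    out on bilinear forms: [Theta] enters through the numbers [dotp (Theta g o u) v], and its
    linearity follows from its symmetry. The hypothesis [operators_of_game] supplies Ito integrals
    for the three pairs of kernels, so what must be proved is that versions agree and that they add.
    Agreement rests on an isometry for simple processes adapted to the augmented filtration, whereas
    [brownian_motion] gives independence of the raw past. The rate 8^-n of completeness is fixed
    once for all: weighting squared increments by 4^n leaves the summable 2^-n, which gives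
    convergence almost everywhere with no extraction of subsequences. *)

Section InnerProductTheory.
Context (R : realType) (V : innerProductType R).
Implicit Types (x y z : V) (a : R).

Lemma dotpDr x y z : dotp x (y + z) = dotp x y + dotp x z.
Proof. by rewrite dotpC dotpDl !(dotpC x). Qed.

Lemma dotpZr a x y : dotp x (a *: y) = a * dotp x y.
Proof. by rewrite dotpC dotpZl dotpC. Qed.

Lemma dot0p x : dotp 0 x = 0.
Proof. by rewrite -(scale0r 0) dotpZl mul0r. Qed.

Lemma dotp0 x : dotp x 0 = 0.
Proof. by rewrite dotpC dot0p. Qed.

Lemma dotNp x y : dotp (- x) y = - dotp x y.
Proof. by rewrite -scaleN1r dotpZl mulN1r. Qed.

Lemma dotpN x y : dotp x (- y) = - dotp x y.
Proof. by rewrite dotpC dotNp dotpC. Qed.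

Lemma dotpBl x y z : dotp (x - y) z = dotp x z - dotp y z.
Proof. by rewrite dotpDl dotNp. Qed.

Lemma dotpBr x y z : dotp x (y - z) = dotp x y - dotp x z.
Proof. by rewrite dotpDr dotpN. Qed.

Definition dotpE := (@dotpDl R V, dotpDr, @dotpZl R V, dotpZr, dot0p, dotp0, dotNp, dotpN).

Lemma dotp_inj x y : (forall z, dotp x z = dotp y z) -> x = y.
Proof.
by move=> h; apply/eqP; rewrite -subr_eq0; apply/eqP/dotp_eq0; rewrite dotpBl h subrr.
Qed.

(** Cauchy-Schwarz in polynomial form. It serves wherever a quadratic expression in [t] is known to
    be nonnegative: in [riesz], in the first-order condition of the game, and for integrals of
    products. *)
Lemma le_quadratic_discriminant (p q r : R) :
  (forall t, 0 <= p + 2 * t * q + t ^+ 2 * r) -> 0 <= r -> q ^+ 2 <= p * r.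
Proof.
move=> h; rewrite le_eqVlt => /orP[/eqP r0|r0].
  have [->|q0] := eqVneq q 0; first by rewrite -r0 mulr0 expr0n.
  (* At this [t] the polynomial, which is affine here, takes the value -1. *)
  have := h (- (p + 1) / (2 * q)).
  have -> : 2 * (- (p + 1) / (2 * q)) * q = - (p + 1) by field.
  by rewrite -r0 mulr0; lra.
(* The minimum of the polynomial is attained at [- q / r]. *)
have := h (- q / r).
have -> : p + 2 * (- q / r) * q + (- q / r) ^+ 2 * r = p - q ^+ 2 / r.
  by field; rewrite gt_eqF.
by rewrite subr_ge0 ler_pdivrMr.
Qed.

Lemma Cauchy_Schwarz x y : dotp x y ^+ 2 <= dotp x x * dotp y y.
Proof.
apply: le_quadratic_discriminant; last exact: dotp_ge0.
move=> t; have := dotp_ge0 (x + t *: y); rewrite !dotpE (dotpC y x).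
by congr (_ <= _); ring.
Qed.

Lemma hnorm_sqr x : hnorm x ^+ 2 = dotp x x.
Proof. by rewrite sqr_sqrtr ?dotp_ge0. Qed.

Lemma hnorm_ge0 x : 0 <= hnorm x.
Proof. exact: sqrtr_ge0. Qed.

(* Completeness, tested on sequences of prescribed geometric rate: enough for
   the Riesz theorem and the form in which it is proved for L2 spaces. *)
Definition hilbert : Prop := forall u : nat -> V,
  (forall m n, (m <= n)%N -> dotp (u n - u m) (u n - u m) <= 8 ^- m) ->
  exists l, exists C, forall n, dotp (l - u n) (l - u n) <= C * 8 ^- n.

Definition bounded_functional (f : V -> R) : Prop :=
  (forall a x y, f (a *: x + y) = a * f x + f y) /\
  exists2 C, 0 <= C & forall x, f x ^+ 2 <= C * dotp x x.

End InnerProductTheory.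

Lemma dotp_pairE (R : realType) (U V : innerProductType R) (x y : (U * V)%type) :
  dotp x y = dotp x.1 y.1 + dotp x.2 y.2.
Proof. by []. Qed.

(** Stands in for a passage to the limit: estimates are made for each [n] with an error of order
    8^-n. It holds because 8^n exceeds [n] and [R] is archimedean. *)
Lemma le0_of_geometric (R : realType) (a C : R) :
  (forall n, a <= C * 8 ^- n) -> a <= 0.
Proof.
move=> h; rewrite leNgt; apply/negP => a0.
have C0 : 0 < C by have := h 0%N; rewrite expr0 invr1 mulr1; exact: lt_le_trans.
have h2 n : (n.+1)%:R * a <= C.
  apply: le_trans (_ : (8 ^+ n) * a <= _); last first.
    rewrite mulrC -ler_pdivlMr ?exprn_gt0//; exact: h.
  rewrite ler_pM2r// -natrX ler_nat.
  exact: ltn_expl.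
have := h2 (Num.truncn (C / a)); apply/negP; rewrite -ltNge.
rewrite -ltr_pdivrMr//; have := Num.Theory.truncnS_gt (C / a); exact.
Qed.

(* The representing vector is the minimizer of [<x, x> - 2 f x]. *)
Lemma riesz (R : realType) (V : innerProductType R) (f : V -> R) :
  hilbert V -> bounded_functional f -> exists y, forall x, f x = dotp y x.
Proof.
move=> cV [fl [C C0 fC]].
pose F x := dotp x x - 2 * f x.
have f0 : f 0 = 0 by have := fl 1 0 0; rewrite scale1r addr0 mul1r; lra.
have fD x y : f (x + y) = f x + f y by have := fl 1 x y; rewrite scale1r mul1r.
have fZ a x : f (a *: x) = a * f x by have := fl a x 0; rewrite !addr0 f0 addr0.
have fN x : f (- x) = - f x by rewrite -scaleN1r fZ mulN1r.
(* Otherwise [2 * f x] exceeds [dotp x x + C]; squaring contradicts the bound on [f x ^+ 2]. *)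
have Flb x : - C <= F x.
  rewrite leNgt; apply/negP; rewrite /F => h.
  have := fC x; have := dotp_ge0 x; have := sqr_ge0 (dotp x x - C).
  have : 0 < 2 * f x - dotp x x - C by lra.
  by nra.
have infF : has_inf (range F).
  by split; [exists (F 0), 0 | exists (- C) => _ [x _ <-]].
pose m := inf (range F).
have mF x : m <= F x by apply: ge_inf; [case: infF | exists x].
have e0 n : 0 < 8 ^- n / 4 :> R by rewrite divr_gt0// invr_gt0 exprn_gt0.
have /choice[u uP] : forall n, exists x, F x < m + 8 ^- n / 4.
  by move=> n; have [_ [x _ <-]] := inf_adherent (e0 n) infF; exists x.
(* Parallelogram law: the squared distance of [u k] and [u n] is twice [F (u k)] plus twice
   [F (u n)] minus four times [F] at the midpoint. The slack 8^-n / 4 in the choice of [u] makes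
   this at most 8^-k. *)
have [k n kn|l [B lP]] := cV u.
  have := mF (2^-1 *: (u k + u n)); have := uP k; have := uP n.
  have : 8 ^- n <= 8 ^- k :> R by rewrite lef_pV2 ?posrE ?exprn_gt0// ler_weXn2l//; lra.
  rewrite /F !dotpE fZ fD (dotpC (u n)); lra.
exists l => z; apply/esym/eqP; rewrite -subr_eq0 -sqrf_eq0 eq_le sqr_ge0 andbT.
apply: (@le0_of_geometric _ _ ((2 * B + 1) * dotp z z)) => n.
(* A near minimizer is nearly stationary: compare [F (u n + t *: z)] with the infimum for all
   [t]. *)
have h1 : (dotp (u n) z - f z) ^+ 2 <= (8 ^- n / 4) * dotp z z.
  apply: le_quadratic_discriminant; last exact: dotp_ge0.
  move=> t; have := mF (u n + t *: z); have := uP n.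
  rewrite /F !dotpE fD fZ (dotpC z); lra.
have h2 : dotp (l - u n) z ^+ 2 <= B * 8 ^- n * dotp z z.
  by apply: le_trans (Cauchy_Schwarz _ _) _; rewrite ler_wpM2r ?dotp_ge0// lP.
have zp := dotp_ge0 z; have ep := e0 n.
have := sqr_ge0 (dotp (l - u n) z - (dotp (u n) z - f z)).
by move: h1 h2; rewrite !dotpE; nra.
Qed.

(** * Operators obtained from the Riesz theorem *)

Section RepresentingOperators.
Context (R : realType) (H K : innerProductType R).

(** Any candidate [M] makes the chosen [adjoint L] correct. For [opU], [Gamma_T] and [opS'] the
    candidate is written down explicitly. *)
Lemma adjoint_ext (L : H -> K) (M : K -> H) :
  (forall x y, dotp (L x) y = dotp x (M y)) ->
  forall x y, dotp (L x) y = dotp x (adjoint L y).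
Proof. by move=> LM; rewrite /adjoint; case: xgetP => [N _ NP|/(_ M)]; [exact: NP|]. Qed.

Lemma operator_of_formP (b : H -> K -> R) : hilbert K ->
  (forall x, bounded_functional (b x)) ->
  forall x y, dotp (operator_of_form b x) y = b x y.
Proof.
move=> cK bb; rewrite /operator_of_form; case: xgetP => [N _ NP|]; first exact: NP.
have /choice[M MP] : forall x, exists y, forall z, b x z = dotp y z.
  by move=> x; exact: riesz.
by move=> /(_ M) [].
Qed.

Lemma adjointP (L : H -> K) : hilbert H -> bounded_operator L ->
  forall x y, dotp (L x) y = dotp x (adjoint L y).
Proof.
move=> cH [Ll [C LC]]; pose b y x := dotp (L x) y.
have /choice[M MP] : forall y, exists m, forall x, b y x = dotp m x.
  move=> y; apply: riesz => //; split=> [a x z|]; first by rewrite /b Ll !dotpE.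
  exists (C ^+ 2 * dotp y y) => [|x]; first by rewrite mulr_ge0 ?sqr_ge0 ?dotp_ge0.
  rewrite mulrAC; apply: le_trans (Cauchy_Schwarz _ _) _.
  rewrite ler_wpM2r ?dotp_ge0// -!hnorm_sqr -exprMn.
  (* [C] may have any sign; [C * hnorm x] is nonnegative because it bounds a norm. *)
  by rewrite ler_pXn2r ?nnegrE ?hnorm_ge0//; apply: le_trans (LC x); exact: hnorm_ge0.
by apply: (@adjoint_ext _ M) => x y; rewrite -/(b y x) MP dotpC.
Qed.

End RepresentingOperators.

(** * Symmetric operators and their pseudo-inverse *)

Section SelfAdjoint.
Context (R : realType) (H : innerProductType R).
Implicit Types (b : H -> H -> R) (M : H -> H) (x y z : H).

(** Symmetry forces linearity, by testing against every vector; the next four lemmas read this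
    off. *)
Definition symmetric_operator M := forall x y, dotp (M x) y = dotp x (M y).

Lemma symmetric_operator0 M : symmetric_operator M -> M 0 = 0.
Proof. by move=> Ms; apply: dotp_inj => z; rewrite Ms !dot0p. Qed.

Lemma symmetric_operatorN M x : symmetric_operator M -> M (- x) = - M x.
Proof. by move=> Ms; apply: dotp_inj => z; rewrite Ms !dotNp Ms. Qed.

Lemma symmetric_operatorZ M (a : R) x : symmetric_operator M -> M (a *: x) = a *: M x.
Proof. by move=> Ms; apply: dotp_inj => z; rewrite Ms !dotpZl Ms. Qed.

Lemma symmetric_operatorD M x y : symmetric_operator M -> M (x + y) = M x + M y.
Proof. by move=> Ms; apply: dotp_inj => z; rewrite Ms !dotpDl !Ms. Qed.

(** Existence is the Riesz theorem. The chosen operator is only known to be symmetric with the right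
    diagonal, and polarization at [x + y] recovers the whole form. *)
Lemma operator_of_quadraticP b : hilbert H -> (forall x y, b x y = b y x) ->
  (forall x, bounded_functional (b x)) ->
  forall x y, dotp (operator_of_quadratic (fun x => b x x) x) y = b x y.
Proof.
move=> cH bC bb.
have bD x y z : b z (x + y) = b z x + b z y.
  by case: (bb z) => /(_ 1 x y); rewrite scale1r mul1r.
have /choice[M MP] : forall x, exists m, forall y, b x y = dotp m y.
  by move=> x; exact: riesz.
rewrite /operator_of_quadratic; case: xgetP => [N _ [Ns Nb] x y|]; last first.
  by move=> /(_ M) []; split=> x; [move=> y|]; rewrite -MP// bC MP dotpC.
have := Nb (x + y); rewrite (symmetric_operatorD _ _ Ns) !dotpE !Nb.
rewrite bD (bC _ x) (bC _ y) !bD (bC y x) (Ns y x) (dotpC y); lra.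
Qed.

(** [M (M (y - z))] vanishes, hence so does [M (y - z)], its squared norm being
    [dotp (y - z) (M (M (y - z)))]. So [y - z] lies in the kernel, which is orthogonal to the
    closure of the range, where [y] and [z] both are. *)
Lemma pseudo_inverse_unique M x y z : symmetric_operator M ->
  [set y | hclosure (range M) y /\ exists2 n, null_space M n & x = n + M y] y ->
  [set y | hclosure (range M) y /\ exists2 n, null_space M n & x = n + M y] z ->
  y = z.
Proof.
move=> Ms [cy [n n0 ->]] [cz [n' n'0 e]].
have M2 : M (M (y - z)) = 0.
  rewrite (symmetric_operatorD _ _ Ms) (symmetric_operatorN _ Ms).
  have -> : M y - M z = n' - n.
    by apply/eqP; rewrite subr_eq -addrA [- n + _]addrC addrA -e addrAC subrr add0r.
  by rewrite (symmetric_operatorD _ _ Ms) (symmetric_operatorN _ Ms) n0 n'0 subrr.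
have M1 : M (y - z) = 0 by apply: dotp_eq0; rewrite Ms M2 dotp0.
have cl w : hclosure (range M) w -> dotp (y - z) w = 0.
  move=> cw; apply/eqP; rewrite -sqrf_eq0 eq_le sqr_ge0 andbT.
  apply: (@le0_of_geometric _ _ (dotp (y - z) (y - z))) => k.
  have e0 : 0 < Num.sqrt (8 ^- k : R) by rewrite sqrtr_gt0 invr_gt0 exprn_gt0.
  have [_ [v _ <-] vw] := cw _ e0.
  have -> : dotp (y - z) w = dotp (y - z) (w - M v).
    by rewrite dotpBr -Ms M1 dot0p subr0.
  apply: le_trans (Cauchy_Schwarz _ _) _; rewrite ler_wpM2l ?dotp_ge0//.
  rewrite -hnorm_sqr -[leRHS]sqr_sqrtr ?invr_ge0 ?exprn_ge0//.
  by rewrite ler_pXn2r ?nnegrE ?hnorm_ge0 ?sqrtr_ge0// ltW.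
by apply/eqP; rewrite -subr_eq0; apply/eqP/dotp_eq0; rewrite dotpBr !cl ?subrr.
Qed.

(** The value is a choice, so on the domain oddness comes from uniqueness. The domain is symmetric,
    and off it both sides are the default 0. *)
Lemma pseudo_inverseN M x : symmetric_operator M ->
  pseudo_inverse M (- x) = - pseudo_inverse M x.
Proof.
move=> Ms.
have opp a (b : H) : [set y | hclosure (range M) y /\ exists2 n, null_space M n & a = n + M y] b ->
  [set y | hclosure (range M) y /\ exists2 n, null_space M n & - a = n + M y] (- b).
  move=> [cb [n n0 ->]]; split.
    move=> e /cb[_ [v _ <-]] h; exists (M (- v)); first by exists (- v).
    by rewrite (symmetric_operatorN _ Ms) -opprD /hnorm dotNp dotpN opprK.
  exists (- n); last by rewrite (symmetric_operatorN _ Ms) opprD.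
  by rewrite /null_space/= (symmetric_operatorN _ Ms) n0 oppr0.
rewrite /pseudo_inverse.
case: (xgetP 0 _) => [y _ yP|nP]; case: (xgetP 0 _) => [z _ zP|nQ].
- by apply: (pseudo_inverse_unique Ms yP); exact: opp.
- by case: (nQ (- y)); have := opp _ _ yP; rewrite opprK.
- by case: (nP (- z)); exact: opp.
- by rewrite oppr0.
Qed.

End SelfAdjoint.

(** * Saddle points of quadratic functionals *)

Section QuadraticGame.
Context (R : realType) (H : innerProductType R) (M : (H * H)%type -> (H * H)%type).
Context (b : (H * H)%type) (c : R) (J : (H * H)%type -> R).
Hypothesis Ms : symmetric_operator M.
Hypothesis JE : forall u, J u = c + 2 * dotp b u + dotp (M u) u.

Let saddle (u : (H * H)%type) :=
  forall v1 v2 : H, J (u.1, v2) <= J u /\ J u <= J (v1, u.2).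

Let J_shift u h : J (u + h) = J u + (2 * dotp (M u + b) h + dotp (M h) h).
Proof.
rewrite !JE (symmetric_operatorD _ _ Ms) !dotpE (Ms h u) (dotpC h (M u)); ring.
Qed.

(** First- and second-order conditions for a minimum at [t = 0] along a line. Adding the cases 1 and
    -1 gives the sign of [r]; then the discriminant forces [q] to vanish. *)
Let sgn_of_quadratic (q r : R) :
  (forall t, 0 <= t * q + t ^+ 2 * r) <-> q = 0 /\ 0 <= r.
Proof.
split=> [h|[-> r0] t]; last by rewrite mulr0 add0r mulr_ge0 ?sqr_ge0.
have r0 : 0 <= r by have := h 1; have := h (- 1); rewrite sqrrN expr1n; lra.
split=> //; apply/eqP; rewrite -sqrf_eq0 eq_le sqr_ge0 andbT.
have h' t : 0 <= 0 + 2 * t * (q / 2) + t ^+ 2 * r.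
  by have := h t; congr (_ <= _); field.
have := le_quadratic_discriminant h' r0; rewrite mul0r.
have -> : (q / 2) ^+ 2 = q ^+ 2 / 4 by field.
by rewrite ler_pdivrMr// mul0r.
Qed.

(** The expansion [J_shift] is exact, so along (w, 0) and (0, w) each saddle inequality says that a
    polynomial in [t] without constant term keeps its sign. The two partial gradients vanish
    separately, which is the vector equation; conversely, once they vanish, only the diagonal
    quadratic terms remain. *)
Lemma saddle_stationary u : saddle u <->
  [/\ forall w, 0 <= dotp (M (w, 0)).1 w,
      forall w, dotp (M (0, w)).2 w <= 0 & M u + b = 0].
Proof.
have shift1 (w : H) t : J (u + t *: (w, 0)) =
    J u + (t * (2 * dotp (M u + b).1 w) + t ^+ 2 * dotp (M (w, 0)).1 w).
  rewrite J_shift (symmetric_operatorZ _ _ Ms) dotpZr dotpZl dotpZr !dotp_pairE/= !dotp0.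
  ring.
have shift2 (w : H) t : J (u + t *: (0, w)) =
    J u + (t * (2 * dotp (M u + b).2 w) + t ^+ 2 * dotp (M (0, w)).2 w).
  rewrite J_shift (symmetric_operatorZ _ _ Ms) dotpZr dotpZl dotpZr !dotp_pairE/= !dotp0.
  ring.
split=> [us|[M1 M2 e] v1 v2].
  have s1 w : 2 * dotp (M u + b).1 w = 0 /\ 0 <= dotp (M (w, 0)).1 w.
    apply/sgn_of_quadratic => t; have [_] := us (u.1 + t *: w) 0.
    have -> : (u.1 + t *: w, u.2) = u + t *: (w, 0).
      by rewrite [RHS]surjective_pairing/= scaler0 addr0.
    by rewrite shift1 lerDl.
  have s2 w : - (2 * dotp (M u + b).2 w) = 0 /\ 0 <= - dotp (M (0, w)).2 w.
    apply/sgn_of_quadratic => t; have [+ _] := us 0 (u.2 + t *: w).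
    have -> : (u.1, u.2 + t *: w) = u + t *: (0, w).
      by rewrite [RHS]surjective_pairing/= scaler0 addr0.
    by rewrite shift2 gerDl !mulrN; lra.
  split=> [w|w|]; [by have [] := s1 w|by have [_] := s2 w; lra|].
  have z1 : (M u + b).1 = 0 by apply: dotp_inj => w; have [+ _] := s1 w; rewrite dot0p; lra.
  have z2 : (M u + b).2 = 0 by apply: dotp_inj => w; have [+ _] := s2 w; rewrite dot0p; lra.
  by rewrite [LHS]surjective_pairing z1 z2.
split.
  have -> : (u.1, v2) = u + 1 *: (0, v2 - u.2).
    by rewrite scale1r [RHS]surjective_pairing/= addr0 addrCA subrr addr0.
  by rewrite shift2 e dot0p gerDl; have := M2 (v2 - u.2); lra.
have -> : (v1, u.2) = u + 1 *: (v1 - u.1, 0).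
  by rewrite scale1r [RHS]surjective_pairing/= addr0 addrCA subrr addr0.
by rewrite shift1 e dot0p lerDl; have := M1 (v1 - u.1); lra.
Qed.

(** The sign conditions do not involve [u], so as soon as a saddle point exists the set of saddle
    points is a translate of the kernel of [M]; this is the uniqueness criterion. *)
Theorem quadratic_game :
  [/\ (exists u, saddle u) <->
        [/\ forall w, 0 <= dotp (M (w, 0)).1 w,
            forall w, dotp (M (0, w)).2 w <= 0 & range M b],
      forall u, saddle u -> M u + b = 0 /\
        exists v, u = - pseudo_inverse M b + (v - pseudo_inverse M (M v)) &
      (exists u, saddle u) -> ((exists! u, saddle u) <-> null_space M = [set 0])].
Proof.
split.
- split=> [[u /saddle_stationary[M1 M2 e]]|[M1 M2 [u _ e]]].
    split=> //; exists (- u) => //.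
    by rewrite (symmetric_operatorN _ Ms); apply/esym/eqP; rewrite -addr_eq0 addrC e.
  exists (- u); apply/saddle_stationary; split=> //.
  by rewrite (symmetric_operatorN _ Ms) e addNr.
- move=> u /saddle_stationary[_ _ e]; split=> //; exists u.
  have -> : M u = - b by apply/eqP; rewrite -addr_eq0 e.
  by rewrite (pseudo_inverseN _ Ms) opprK addrCA addNr addr0.
- move=> [u us]; have /saddle_stationary[M1 M2 e] := us; split=> [[w [ws wu]]|n0].
    have we v : saddle v -> v = u by move=> /wu <-; rewrite (wu u us).
    rewrite eqEsubset; split=> [v v0|_ ->]; last exact: symmetric_operator0.
    have : saddle (u + v).
      apply/saddle_stationary; split=> //.
      by rewrite (symmetric_operatorD _ _ Ms) v0 addr0.
    by move=> /we /eqP; rewrite -subr_eq0 addrAC subrr add0r => /eqP.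
  exists u; split=> // v /saddle_stationary[_ _ e'].
  have : null_space M (u - v).
    rewrite /null_space/= (symmetric_operatorD _ _ Ms) (symmetric_operatorN _ Ms).
    by rewrite -(addrKA b) e [b + _]addrC e' subrr.
  by rewrite n0 => /eqP; rewrite subr_eq0 => /eqP.
Qed.

End QuadraticGame.

(** * Completeness of L2 spaces *)

(** The increments are dominated by [(C + 1)] times 2^-n. The bound [C + 1] replaces a square root
    of [C]: a nonnegative [y] with y^2 at most [C] satisfies 2 y <= y^2 + 1. *)
Lemma geometric_increments_cvg (R : realType) (u : nat -> R) (C : R) :
  (forall n, 4 ^+ n * (u n.+1 - u n) ^+ 2 <= C) -> cvgn u.
Proof.
move=> uC.
have h : cvgn (series (telescope u)).
  apply: normed_cvg; apply: (@series_le_cvg _ _ (geometric (C + 1) 2^-1)) => //.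
  - by move=> n; rewrite /= normr_ge0.
  - move=> n; rewrite /geometric/= mulr_ge0 ?exprn_ge0// addr_ge0//.
    by apply: le_trans (uC 0%N); rewrite mulr_ge0 ?sqr_ge0 ?exprn_ge0.
  - move=> n; rewrite /geometric/= /telescope/= exprVn ler_pdivlMr ?exprn_gt0//.
    have := uC n; rewrite (_ : 4 = 2 ^+ 2); last by ring.
    rewrite -exprM mulnC exprM -exprMn -real_normK ?num_real// normrM.
    rewrite (ger0_norm (exprn_ge0 n (ler0n _ 2))) mulrC => h.
    by have := sqr_ge0 (`|u n.+1 - u n| * 2 ^+ n - 1); nra.
  - by apply: is_cvg_geometric_series; rewrite ger0_norm; lra.
rewrite telescopeK in h.
have -> : u = [sequence u n - u 0%N]_n + cst (u 0%N).
  by apply/funext => n; rewrite /= addrfctE subrK.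
by apply: is_cvgD => //; exact: is_cvg_cst.
Qed.

Section RieszFischer.
Context d (X : measurableType d) (R : realType) (mu : {measure set X -> \bar R}).
Context (D : set X) (mD : measurable D).

(** With the weight 4^n the squared increments have integrals at most 2^-n. Their sum is thus
    integrable, hence finite almost everywhere, and it bounds each weighted term at the point. *)
Lemma geometric_L2_ae_cvg (f : nat -> X -> R) :
  (forall n, measurable_fun D (f n)) ->
  (forall n, \int[mu]_(x in D) ((f n.+1 x - f n x) ^+ 2)%:E <= (8 ^- n)%:E)%E ->
  {ae mu, forall x, D x -> cvgn (f ^~ x)}.
Proof.
move=> mf f8.
pose g n x := (4 ^+ n * (f n.+1 x - f n x) ^+ 2)%:E.
have mg n : measurable_fun D (g n).
  apply/measurable_EFinP; apply: measurable_funM; first exact: measurable_cst.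
  by apply: measurable_funX; exact: measurable_funB.
have g0 n x : D x -> (0 <= g n x)%E.
  by move=> _; rewrite lee_fin mulr_ge0 ?sqr_ge0 ?exprn_ge0.
have ig : (\int[mu]_(x in D) (\sum_(0 <= n <oo) g n x) <= 2%:E)%E.
  rewrite integral_nneseries//; apply: le_trans (epsilon_trick0 xpredT (_ : 0 <= 2)) => //.
  apply: lee_nneseries => [n _ _|n _]; first by apply: integral_ge0 => x Dx; exact: g0.
  rewrite (_ : \int[mu]_(x in D) _ =
      (4 ^+ n)%:E * \int[mu]_(x in D) ((f n.+1 x - f n x) ^+ 2)%:E)%E; last first.
    rewrite -ge0_integralZl//.
    + by apply/measurable_EFinP; apply: measurable_funX; exact: measurable_funB.
    + by move=> x _; rewrite lee_fin sqr_ge0.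
  apply: le_trans (lee_wpmul2l _ (f8 n)) _; first by rewrite lee_fin exprn_ge0.
  rewrite -EFinM lee_fin natrX exprS.
  have -> : 8 = 4 * 2 :> R by ring.
  rewrite exprMn invfM mulrA divff ?expf_neq0// mul1r.
  by rewrite invfM mulrA divff// mul1r.
have iG : mu.-integrable D (fun x => \sum_(0 <= n <oo) g n x)%E.
  apply/integrableP; split; first by apply: (@ge0_emeasurable_sum _ _ _ _ g xpredT) =>
      // k x Dx _; exact: g0.
  rewrite (eq_integral (fun x => \sum_(0 <= n <oo) g n x)%E).
    by apply: le_lt_trans ig _; rewrite ltry.
  by move=> x /set_mem Dx; rewrite gee0_abs// nneseries_ge0// => n _ _; exact: g0.
move: (integrable_ae mD iG); apply: filterS => x h Dx.
have /fineK Gx := h Dx.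
apply: (@geometric_increments_cvg _ _ (fine (\sum_(0 <= n <oo) g n x)%E)) => n.
rewrite -lee_fin Gx -/(g n x); apply: le_trans (nneseries_lim_ge n.+1 _).
  by rewrite big_nat_recr//= leeDr// sume_ge0// => i _; exact: g0.
by move=> *; exact: g0.
Qed.

(** The limit is given by a formula at every point, so that measurability of each time section
    passes to it. The estimate is Fatou's lemma in [n] at fixed [m], the formula being the true
    limit almost everywhere. *)
Lemma riesz_fischer (f : nat -> X -> R) :
  (forall n, measurable_fun D (f n)) ->
  (forall m n, (m <= n)%N ->
    \int[mu]_(x in D) ((f n x - f m x) ^+ 2)%:E <= (8 ^- m)%:E)%E ->
  forall m, (\int[mu]_(x in D)
    ((fine (limn_esup (fun n => (f n x)%:E)) - f m x) ^+ 2)%:E <= (8 ^- m)%:E)%E.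
Proof.
move=> mf f8 m; have fc := geometric_L2_ae_cvg mf (fun n => f8 n n.+1 (leqnSn n)).
pose l x := fine (limn_esup (fun n => (f n x)%:E)).
have ml : measurable_fun D l.
  apply: measurableT_comp; first exact: fine_measurable.
  by apply: measurable_fun_limn_esup => n; exact/measurable_EFinP.
have msq n : measurable_fun D (fun x => ((f n x - f m x) ^+ 2)%:E).
  by apply/measurable_EFinP; apply: measurable_funX; exact: measurable_funB.
rewrite (@ge0_ae_eq_integral _ _ _ mu D _ (fun x => limn_einf (fun n =>
    ((f n x - f m x) ^+ 2)%:E)))//.
- apply: le_trans (fatou mu mD msq _) _; first by move=> n x _; rewrite lee_fin sqr_ge0.
  rewrite limn_einf_lim; apply: lime_le; first exact: is_cvg_einfs.
  (* The infimum runs over the indices from [n] on; [maxn n m] is one of them at which the rate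
     relative to [m] applies. *)
  apply: nearW => n; apply: le_trans (_ : _ <=
      \int[mu]_(x in D) ((f (maxn n m) x - f m x) ^+ 2)%:E)%E _.
    by apply: ereal_inf_lbound; exists (maxn n m) => //=; rewrite leq_maxl.
  by apply: f8; rewrite leq_maxr.
- by apply/measurable_EFinP; apply: measurable_funX; exact: measurable_funB.
- apply: measurableT_comp; first exact: oppe_measurable.
  apply: measurable_fun_limn_esup => n; apply: measurableT_comp => //; exact: oppe_measurable.
- by move=> x _; rewrite lee_fin sqr_ge0.
- move=> x _; rewrite limn_einf_lim; apply: lime_ge; first exact: is_cvg_einfs.
  by apply: nearW => n; apply: le_ereal_inf_tmp => _ [k _ <-]; rewrite lee_fin sqr_ge0.
- move: fc; apply: filterS => x h Dx; have := h Dx => /cvg_ex[/= y fy].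
  have ye : (f n x)%:E @[n --> \oo] --> y%:E by apply: cvg_EFin => //; exact: nearW.
  rewrite (cvg_limn_einf_sup ye)/=; apply/esym.
  have : ((f n x - f m x) ^+ 2)%:E @[n --> \oo] --> ((y - f m x) ^+ 2)%:E.
    by apply: cvg_EFin; [exact: nearW|apply: cvgM; apply: cvgB => //; exact: cvg_cst].
  by move=> /cvg_limn_einf_sup[-> _].
Qed.

End RieszFischer.

(** * Classes, representatives and completeness *)

Section L2spaceTheory.
Context d (X : measurableType d) (R : realType) (mu : {measure set X -> \bar R}).
Context (D : set X) (mD : measurable D) (S : submodClosed (X -> R)).

Local Notation E := (L2space mu mD S).
Implicit Types (f g : X -> R).

Lemma L2fun_square_integrable f : f \in L2fun mu D S -> square_integrable mu D f.
Proof. by move=> /andP[_ /asboolP]. Qed.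

Lemma L2val_L2fun (x : E) : L2val x \in L2fun mu D S.
Proof. exact: valP. Qed.

Lemma L2val_in (x : E) : L2val x \in S.
Proof. by have /andP[] := L2val_L2fun x. Qed.

Lemma L2val_square_integrable (x : E) : square_integrable mu D (L2val x).
Proof. exact: L2fun_square_integrable (L2val_L2fun x). Qed.

Lemma dotp_L2val (x y : E) : dotp x y = Rintegral mu D (fun z => L2val x z * L2val y z).
Proof. by []. Qed.

Lemma integral_square (f : X -> R) : square_integrable mu D f ->
  (\int[mu]_(x in D) (f x ^+ 2)%:E)%E = (Rintegral mu D (fun x => f x * f x))%:E.
Proof.
move=> sf; rewrite /Rintegral fineK//.
exact: integrable_fin_num (mul_integrable mD sf sf).
Qed.

Lemma dotp_L2val_sqr (x : E) : (dotp x x)%:E = (\int[mu]_(z in D) (L2val x z ^+ 2)%:E)%E.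
Proof. by rewrite integral_square//; exact: L2val_square_integrable. Qed.

Lemma integral_square_eq0 (f : X -> R) : measurable_fun D f ->
  (\int[mu]_(x in D) (f x ^+ 2)%:E)%E = 0%E ->
  {ae mu, forall x, D x -> f x = 0}.
Proof.
move=> mf f0; have : ae_eq mu D (fun x => (f x ^+ 2)%:E) (cst 0%E).
  apply/ae_eq_integral_abs => //; first by apply/measurable_EFinP; exact: measurable_funX.
  by rewrite -[RHS]f0; apply: eq_integral => x _; rewrite gee0_abs// lee_fin sqr_ge0.
by apply: filterS => x h /h[] /eqP; rewrite sqrf_eq0 => /eqP.
Qed.

(** The quotient identifies functions at distance zero. Everything about the representative [L2val],
    which is an arbitrary choice, goes through this lemma. *)
Lemma L2class_eq (f g : L2sub mu D S) :
  (\pi_(Defs.separated (L2semi mu mD S)) f)%qT = (\pi_(Defs.separated (L2semi mu mD S)) g)%qT ->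
  {ae mu, forall x, D x -> val f x = val g x}.
Proof.
move=> /eqP; rewrite eqmodE => /eqP/= fg0.
have h := proj2_sig (f - g).
have sfg : square_integrable mu D (fun x => val f x - val g x).
  exact: (L2fun_square_integrable (h mD mD)).
have [mfg _] := sfg.
have : {ae mu, forall x, D x -> val f x - val g x = 0}.
  by apply: integral_square_eq0 => //; rewrite integral_square// -[RHS]/(0%:E) -fg0.
by apply: filterS => x k /k /eqP; rewrite subr_eq0 => /eqP.
Qed.

Lemma L2val_class f (hf : f \in L2fun mu D S) :
  {ae mu, forall x, D x -> L2val (L2class mD hf) x = f x}.
Proof.
by apply: (@L2class_eq (repr (L2class mD hf : Defs.separated (L2semi mu mD S))) (exist _ f hf));
    rewrite reprK.
Qed.

Lemma L2valD (x y : E) : {ae mu, forall z, D z -> L2val (x + y) z = L2val x z + L2val y z}.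
Proof.
apply: (@L2class_eq (repr (x + y : Defs.separated (L2semi mu mD S)))
  (repr (x : Defs.separated (L2semi mu mD S)) + repr (y : Defs.separated (L2semi mu mD S)))).
by rewrite reprK.
Qed.

Lemma L2valZ (a : R) (x : E) : {ae mu, forall z, D z -> L2val (a *: x) z = a * L2val x z}.
Proof.
apply: (@L2class_eq (repr (a *: x : Defs.separated (L2semi mu mD S)))
  (a *: repr (x : Defs.separated (L2semi mu mD S)))).
by rewrite reprK.
Qed.

Lemma L2valN (x : E) : {ae mu, forall z, D z -> L2val (- x) z = - L2val x z}.
Proof. by rewrite -scaleN1r; have := L2valZ (- 1) x; apply: filterS => z h /h ->; rewrite mulN1r.
    Qed.

Lemma L2valB (x y : E) : {ae mu, forall z, D z -> L2val (x - y) z = L2val x z - L2val y z}.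
Proof.
have := L2valN y; have := L2valD x (- y).
by apply: filterS2 => z h k Dz; rewrite h// k.
Qed.

Lemma L2space_eq (x y : E) : {ae mu, forall z, D z -> L2val x z = L2val y z} -> x = y.
Proof.
move=> xy; apply/eqP; rewrite -subr_eq0; apply/eqP/dotp_eq0.
apply: EFin_inj; rewrite dotp_L2val_sqr; apply: (etrans _ (integral0 mu D)).
have [m _] := L2val_square_integrable (x - y).
apply: ge0_ae_eq_integral => //.
- by apply/measurable_EFinP; exact: measurable_funX.
- by move=> z _; rewrite lee_fin sqr_ge0.
- have := L2valB x y; move: xy; apply: filterS2 => z h k Dz.
  by rewrite k// h// subrr expr0n.
Qed.

(** The hypothesis on [S] is stability under the limit formula of [riesz_fischer]. *)
Lemma L2space_hilbert :
  (forall f : nat -> X -> R, (forall n, f n \in S) ->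
    (fun x => fine (limn_esup (fun n => (f n x)%:E))) \in S) ->
  hilbert E.
Proof.
move=> Slim u u8; pose f n := L2val (u n).
have sf n : square_integrable mu D (f n) := L2val_square_integrable (u n).
have mf n : measurable_fun D (f n) by have [] := sf n.
have f8 m n : (m <= n)%N ->
    (\int[mu]_(x in D) ((f n x - f m x) ^+ 2)%:E <= (8 ^- m)%:E)%E.
  move=> mn; have := u8 m n mn; rewrite -lee_fin dotp_L2val_sqr; apply: le_trans.
  have [md _] := L2val_square_integrable (u n - u m).
  rewrite le_eqVlt; apply/orP; left; apply/eqP; apply: ge0_ae_eq_integral => //.
  - by apply/measurable_EFinP; apply: measurable_funX; exact: measurable_funB.
  - by apply/measurable_EFinP; exact: measurable_funX.
  - by move=> z _; rewrite lee_fin sqr_ge0.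
  - by move=> z _; rewrite lee_fin sqr_ge0.
  - by have := L2valB (u n) (u m); apply: filterS => z h Dz; rewrite h.
have l8 := riesz_fischer mD mf f8.
pose l x := fine (limn_esup (fun n => (f n x)%:E)).
have ml : measurable_fun D l.
  apply: measurableT_comp; first exact: fine_measurable.
  by apply: measurable_fun_limn_esup => n; exact/measurable_EFinP.
have lS : l \in S by apply: Slim => n; exact: L2val_in.
(* Square integrability of [l] comes from its difference with [f 0], whose squared norm is at most
   8^-0. *)
have dL : (fun x => l x - f 0%N x) \in L2fun mu D S.
  rewrite /L2fun unfold_in/=; apply/andP; split.
    rewrite (_ : (fun x => _) = l + (- 1) *: f 0%N).
      by rewrite rpredD// rpredZ// L2val_in.
    by rewrite scaleN1r.
  apply/asboolP; split; first exact: measurable_funB.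
  by apply: le_lt_trans (l8 0%N) _; rewrite ltry.
have lL : l \in L2fun mu D S.
  have := L2val_L2fun (u 0%N) => h.
  have -> : l = (fun x => l x - f 0%N x) + L2val (u 0%N).
    by apply/funext => x; rewrite addrfctE subrK.
  exact: rpredD.
exists (L2class mD lL), 1 => n; rewrite mul1r.
rewrite -lee_fin dotp_L2val_sqr; apply: le_trans (l8 n).
have [md _] := L2val_square_integrable (L2class mD lL - u n).
rewrite le_eqVlt; apply/orP; left; apply/eqP; apply: ge0_ae_eq_integral => //.
- by apply/measurable_EFinP; exact: measurable_funX.
- by apply/measurable_EFinP; apply: measurable_funX; exact: measurable_funB.
- by move=> z _; rewrite lee_fin sqr_ge0.
- by move=> z _; rewrite lee_fin sqr_ge0.
- have := L2valB (L2class mD lL) (u n); have := L2val_class lL.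
  by apply: filterS2 => z h k Dz; rewrite k// h.
Qed.

End L2spaceTheory.

Lemma hilbert_pair (R : realType) (U V : innerProductType R) :
  hilbert U -> hilbert V -> hilbert (U * V)%type.
Proof.
move=> hU hV u u8.
have [m n mn|l [B lP]] := hU (fst \o u).
  by apply: le_trans (u8 m n mn); rewrite [leRHS]dotp_pairE/= lerDl dotp_ge0.
have [m n mn|k [C kP]] := hV (snd \o u).
  by apply: le_trans (u8 m n mn); rewrite [leRHS]dotp_pairE/= lerDr dotp_ge0.
exists (l, k), (B + C) => n.
by rewrite dotp_pairE/= mulrDl; apply: lerD; [exact: lP|exact: kP].
Qed.

(** * Brownian increments *)

Section NormalMoments.
Context (R : realType).
Local Notation mu := (@lebesgue_measure R).
Local Open Scope ereal_scope.

(** Change of variables with the Radon-Nikodym density, which equals [normal_pdf] almost everywhere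
    since both have the same integral over every measurable set. *)
Lemma ge0_integral_normal (m s : R) (f : R -> \bar R) :
  measurable_fun setT f -> (forall x, 0 <= f x) ->
  \int[normal_prob m s]_x f x = \int[mu]_x (f x * (normal_pdf m s x)%:E).
Proof.
move=> mf f0; have dom := normal_prob_dominates m s.
rewrite -(Radon_Nikodym_SigmaFinite.change_of_variables dom)//.
have mpdf : measurable_fun setT (EFin \o normal_pdf m s).
  by apply/measurable_EFinP; exact: measurable_normal_pdf.
have mRN := measurable_int _ (Radon_Nikodym_SigmaFinite.f_integrable dom).
apply: ae_eq_integral => //.
- exact: emeasurable_funM.
- exact: emeasurable_funM.
- apply: ae_eqe_mul2l; apply: integral_ae_eq => //.
  + exact: Radon_Nikodym_SigmaFinite.f_integrable.
  + by move=> E _ mE; rewrite -Radon_Nikodym_SigmaFinite.f_integral.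
Qed.

Lemma integral_lebesgueN (f : R -> \bar R) : measurable_fun setT f ->
  (forall x, 0 <= f x) -> \int[mu]_x f (- x)%R = \int[mu]_x f x.
Proof.
move=> mf f0.
rewrite (_ : [set: R] = (-%R : _ -> measurableTypeR R) @^-1` [set: R])//.
rewrite -ge0_integral_pushforward//=.
by apply: eq_measure_integral => A mA _; exact: lebesgue_measureN.
Qed.

Lemma normal_symmetric (s : R) (f : R -> \bar R) : (s != 0)%R -> measurable_fun setT f ->
  (forall x, 0 <= f x) ->
  \int[normal_prob 0 s]_x f (- x)%R = \int[normal_prob 0 s]_x f x.
Proof.
move=> s0 mf f0; have mpdf : measurable_fun setT (EFin \o normal_pdf 0%R s).
  by apply/measurable_EFinP; exact: measurable_normal_pdf.
rewrite !ge0_integral_normal//; last first.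
  by apply: measurableT_comp => //; exact: oppr_measurable.
rewrite -integral_lebesgueN; last 2 first.
- apply: emeasurable_funM => //.
  by apply: measurableT_comp => //; exact: oppr_measurable.
- by move=> x; rewrite mule_ge0// lee_fin normal_pdf_ge0.
apply: eq_integral => x _; rewrite opprK !normal_pdfE// /normal_fun !subr0 sqrrN.
by [].
Qed.

(* The value is 1, but only finiteness is used: any constant serves in the isometry below. *)
Definition normal_square : R := fine (\int[normal_prob (0%R : R) 1]_x (x ^+ 2)%:E).

Lemma normal_square_fin : (normal_square%:E = \int[normal_prob (0%R : R) 1]_x (x ^+ 2)%:E).
Proof.
rewrite fineK// ge0_fin_numE; last by apply: integral_ge0 => x _; rewrite lee_fin sqr_ge0.
rewrite ge0_integral_normal//; last 2 first.
- by apply/measurable_EFinP; exact: measurable_funX.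
- by move=> x; rewrite lee_fin sqr_ge0.
(* Half of the exponent absorbs the square: x^2 exp(-x^2/4) <= 4, because exp(y) >= 1 + y. What is
   left is the density of variance 2, up to the ratio of the normalizing factors. *)
pose s : R := Num.sqrt 2; have s0 : (s != 0)%R by rewrite gt_eqF// sqrtr_gt0.
pose C : R := (4 * normal_peak 1 / normal_peak s)%R.
have C0 : (0 <= C)%R by rewrite !mulr_ge0// ?invr_ge0 ?normal_peak_ge0.
have mpdf r : measurable_fun setT (EFin \o normal_pdf (0%R : R) r).
  by apply/measurable_EFinP; exact: measurable_normal_pdf.
apply: (@le_lt_trans _ _ (\int[mu]_x (C%:E * (normal_pdf 0 s x)%:E))).
  apply: ge0_le_integral => //.
  - by move=> x _; rewrite mule_ge0// lee_fin ?sqr_ge0// normal_pdf_ge0.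
  - apply: emeasurable_funM; last exact: mpdf.
    by apply/measurable_EFinP; exact: measurable_funX.
  - by apply: emeasurable_funM; [exact: measurable_cst|exact: mpdf].
  - move=> x _; rewrite -!EFinM lee_fin !normal_pdfE// /normal_fun !subr0.
    have ps0 : (normal_peak s != 0)%R by rewrite gt_eqF// normal_peak_gt0.
    have -> e : (C * (normal_peak s * e) = normal_peak 1 * (4 * e))%R by rewrite /C; field.
    rewrite mulrCA ler_wpM2l ?normal_peak_ge0// expr1n sqr_sqrtr//.
    rewrite (_ : - x ^+ 2 / (1 *+ 2) = - (x ^+ 2 / 4) - x ^+ 2 / 4)%R; last by field.
    rewrite (_ : - x ^+ 2 / (2 *+ 2) = - (x ^+ 2 / 4))%R; last by field.
    rewrite expRD mulrA ler_pM2r ?expR_gt0// expRN ler_pdivrMr ?expR_gt0//.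
    by have := expR_ge1Dx (x ^+ 2 / 4); lra.
rewrite ge0_integralZl//; [|exact: mpdf|by move=> x _; rewrite lee_fin normal_pdf_ge0].
by rewrite integral_normal_pdf mule1 ltry.
Qed.

Lemma normal_second_moment (s : R) : (0 < s)%R ->
  \int[normal_prob 0 s]_x (x ^+ 2)%:E = (normal_square * s ^+ 2)%:E.
Proof.
move=> s0; have s0' : (s != 0)%R by rewrite gt_eqF.
have msq : measurable_fun [set: R] (fun x : R => (x ^+ 2)%:E).
  by apply/measurable_EFinP; exact: measurable_funX.
have sq0 (x : R) : 0 <= (x ^+ 2)%:E by rewrite lee_fin sqr_ge0.
rewrite EFinM normal_square_fin !ge0_integral_normal// muleC.
have mpdf r : measurable_fun setT (EFin \o normal_pdf (0%R : R) r).
  by apply/measurable_EFinP; exact: measurable_normal_pdf.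
rewrite -ge0_integralZl//; last 2 first.
- by apply: emeasurable_funM => //; exact: mpdf.
- by move=> x _; rewrite mule_ge0// lee_fin normal_pdf_ge0.
(* Scaling by [s] carries the standard normal law to the one of deviation [s]. *)
pose F (x : R^o) : R^o := (x * s)%R.
have F'E : (F^`())%classic = cst s.
  apply/funext => x; rewrite /F derive1E deriveM// derive_cst scaler0 add0r.
  by rewrite derive_id scaler1.
under eq_integral do rewrite -EFinM.
rewrite (@increasing_ge0_integration_by_substitutionT _ F (fun x => (x ^+ 2 * normal_pdf 0 s x)%R)).
- have peakE : (normal_peak s * s = normal_peak 1)%R.
    rewrite /normal_peak expr1n mul1r -mulrnAr sqrtrM ?sqr_ge0// sqrtr_sqr gtr0_norm//.
    by rewrite invfM mulrAC mulVf// mul1r.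
  have funE x : normal_fun 0 s (x * s) = normal_fun 0 1 x.
    rewrite /normal_fun !subr0; congr expR; field.
    by [].
  apply: eq_integral => x _; rewrite F'E ?fctE /F/= -?EFinM; congr EFin.
  rewrite !normal_pdfE ?oner_eq0// funE -peakE; ring.
- by move=> x y xy; rewrite /F ltr_pM2r.
- by rewrite F'E => ?; exact: cvg_cst.
- by rewrite F'E; exact: is_cvg_cst.
- by rewrite F'E; exact: is_cvg_cst.
- by [].
- by apply/gt0_cvgMlNy.
- by apply/gt0_cvgMly.
- move=> x; apply: cvgM; first exact: sqr_continuous.
  exact: continuous_normal_pdf.
- by move=> x; rewrite mulr_ge0 ?sqr_ge0// normal_pdf_ge0.
Qed.

End NormalMoments.

(** * Product rule for independent variables *)

Section Independence.
Context d (Omega : measurableType d) (R : realType) (P : probability Omega R).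
Local Open Scope ereal_scope.

(** Independence on rectangles determines the joint law of [f] and [Y] as the product of their laws;
    the rest is Fubini. The function [g] stays outside [Y], so that independence of an increment
    also serves for its square. *)
Lemma independent_expectation (f Y : Omega -> R) (g : R -> R) :
  measurable_fun setT f -> measurable_fun setT Y -> measurable_fun setT g ->
  (forall A B, measurable A -> measurable B ->
    P (f @^-1` A `&` Y @^-1` B) = P (f @^-1` A) * P (Y @^-1` B)) ->
  P.-integrable setT (EFin \o f) -> P.-integrable setT (EFin \o (g \o Y)) ->
  P.-integrable setT (fun w => (f w * g (Y w))%:E) /\
  \int[P]_w (f w * g (Y w))%:E = (\int[P]_w (f w)%:E) * (\int[P]_w (g (Y w))%:E).
Proof.
move=> mf mY mg fY fi gi.
pose f' : {RV P >-> R} := HB.pack f (isMeasurableFun.Build _ _ _ _ _ mf).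
pose Y' : {RV P >-> R} := HB.pack Y (isMeasurableFun.Build _ _ _ _ _ mY).
pose m1 := distribution P f'; pose m2 := distribution P Y'.
pose Z w := (f w, Y w).
have mZ : measurable_fun setT Z by exact: measurable_fun_pair.
pose h (z : R * R) : \bar R := (z.1 * g z.2)%:E.
have mh : measurable_fun setT h.
  apply/measurable_EFinP; apply: measurable_funM; first exact: measurable_fst.
  by apply: measurableT_comp => //; exact: measurable_snd.
have Zlaw (X : set (R * R)) : measurable X -> (m1 \x m2) X = pushforward P Z X.
  by move=> mX; apply: (product_measure_unique _ mX) => A B mA mB; rewrite -fY.
have eqM (k : R * R -> \bar R) :
    \int[pushforward P Z]_z k z = \int[m1 \x m2]_z k z.
  by apply: eq_measure_integral => A mA _; apply: etrans (esym (Zlaw A mA)) _.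
have int1 (k : R -> \bar R) : measurable_fun setT k -> (forall x, 0 <= k x) ->
    \int[m1]_x k x = \int[P]_w k (f w).
  by move=> mk k0; rewrite ge0_integral_pushforward.
have int2 (k : R -> \bar R) : measurable_fun setT k -> (forall x, 0 <= k x) ->
    \int[m2]_x k x = \int[P]_w k (Y w).
  by move=> mk k0; rewrite ge0_integral_pushforward.
have i1 : m1.-integrable setT (EFin : R -> \bar R).
  apply/integrableP; split; first exact/measurable_EFinP.
  by rewrite int1//; [case/integrableP: fi|exact: measurableT_comp].
have i2 : m2.-integrable setT (EFin \o g).
  apply/integrableP; split; first exact/measurable_EFinP.
  rewrite (int2 (fun x => `|(EFin \o g) x|))//; first by case/integrableP: gi.
  by apply: measurableT_comp => //; exact/measurable_EFinP.
have iZ : (m1 \x m2).-integrable setT h.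
  apply/integrableP; split=> //.
  rewrite fubini_tonelli1//; last exact: measurableT_comp.
  have c0 : 0 <= \int[m2]_y `|(g y)%:E| by exact: integral_ge0.
  have cfin : \int[m2]_y `|(g y)%:E| \is a fin_num.
    by rewrite ge0_fin_numE//; case/integrableP: i2.
  rewrite (eq_integral (fun x : R => `|x%:E| * \int[m2]_y `|(g y)%:E|)); last first.
    move=> x _; rewrite /fubini_F -ge0_integralZl//; last first.
      by apply: measurableT_comp => //; exact/measurable_EFinP.
    by apply: eq_integral => y _; rewrite /h EFinM abseM.
  rewrite ge0_integralZr//; last by apply: measurableT_comp.
  rewrite lte_mul_pinfty//; [exact: integral_ge0| |by case/integrableP: i2].
  by rewrite ge0_fin_numE//; [case/integrableP: i1|exact: integral_ge0].
have iP : P.-integrable setT (h \o Z).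
  apply/integrableP; split; first exact: measurableT_comp.
  have -> : \int[P]_w `|(h \o Z) w| = \int[pushforward P Z]_z `|h z|.
    by rewrite ge0_integral_pushforward//; exact: measurableT_comp.
  by rewrite eqM; case/integrableP: iZ.
split=> //; transitivity (\int[pushforward P Z]_z h z).
  by rewrite integral_pushforward.
rewrite eqM -integral12_prod_meas1//.
have c2 : \int[m2]_y (g y)%:E = \int[P]_w (g (Y w))%:E.
  by rewrite integral_pushforward//; exact/measurable_EFinP.
have c1 : \int[m1]_y y%:E = \int[P]_w (f w)%:E by rewrite integral_pushforward.
have fin2 := integrable_fin_num measurableT i2.
rewrite -c1 -c2 -(fineK fin2) -integralZr//; apply: eq_integral => x _.
by rewrite (fineK fin2) /fubini_F -integralZl.
Qed.

Lemma negligible_symdiff_measure (A B : set Omega) : measurable A -> measurable B ->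
  P.-negligible (A `\` B) -> P.-negligible (B `\` A) -> P A = P B.
Proof.
move=> mA mB /(negligibleP P (measurableD mA mB)) AB /(negligibleP P (measurableD mB mA)) BA.
have := measureDI P mA mB; have := measureDI P mB mA.
by rewrite [in X in X -> _]setIC => -> ->; rewrite [in RHS]BA AB.
Qed.

End Independence.

Section BrownianIncrements.
Context d (Omega : measurableType d) (R : realType) (P : probability Omega R).
Context (T : R) (W : R -> {RV P >-> R}) (W_brownian : brownian_motion T W).

Let past (s : R) : set (set Omega) := [set C | exists r D,
  [/\ 0 <= r <= s, measurable D & C = W r @^-1` D]].

Let past_measurable s : past s `<=` measurable.
Proof. by move=> _ [r [D [_ mD ->]]]; exact: measurable_funPTI. Qed.

Lemma natural_filtration_measurable s : natural_filtration W s `<=` measurable.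
Proof.
apply: smallest_sub; first exact: sigma_algebra_measurable.
by move=> A [[r [B [_ mB ->]]]|[]]//; exact: measurable_funPTI.
Qed.

Lemma natural_filtration_sub s t : s <= t ->
  natural_filtration W s `<=` natural_filtration W t.
Proof.
move=> st; apply: sub_sigma_algebra2 => A [[r [B [/andP[r0 rs] mB ->]]]|nA]; last by right.
by left; exists r, B; rewrite r0 (le_trans rs).
Qed.

(* Independence survives the augmentation by null sets because every augmented event agrees
   with a raw one up to a null set. *)
Let approx s : set (set Omega) := [set A | measurable A /\
  exists A', [/\ <<s past s >> A', P.-negligible (A `\` A') & P.-negligible (A' `\` A)]].

Let past_measurable2 s : <<s past s >> `<=` measurable.
Proof.
by apply: smallest_sub; [exact: sigma_algebra_measurable|exact: past_measurable].
Qed.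

Let approx_sigma s : sigma_algebra setT (approx s).
Proof.
have [p0 pC pU] := smallest_sigma_algebra setT (past s).
split.
- split=> //; exists set0; split=> //; rewrite setD0; exact: negligible_set0.
- move=> A [mA [A' [pA n1 n2]]]; split; first exact: measurableD.
  exists (setT `\` A'); split; first exact: pC.
    by rewrite !setTD setDE setCK setIC -setDE.
  by rewrite !setTD setDE setCK setIC -setDE.
- move=> F FA; split; first by apply: bigcupT_measurable => n; have [] := FA n.
  have /choice[F' F'P] := fun n => (FA n).2.
  exists (\bigcup_n F' n); split.
  + by apply: pU => n; have [] := F'P n.
  + apply: (@negligibleS _ _ _ _ (\bigcup_n (F n `\` F' n))).
      by move=> x [[n _ Fx] nF]; exists n => //; split=> // F'x; apply: nF; exists n.
    by apply: negligible_bigcup => n; have [] := F'P n.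
  + apply: (@negligibleS _ _ _ _ (\bigcup_n (F' n `\` F n))).
      by move=> x [[n _ Fx] nF]; exists n => //; split=> // F'x; apply: nF; exists n.
    by apply: negligible_bigcup => n; have [] := F'P n.
Qed.

Let natural_filtration_approx s : natural_filtration W s `<=` approx s.
Proof.
apply: smallest_sub; first exact: approx_sigma.
move=> A [[r [B [r0 mB ->]]]|[mA A0]].
  split; first exact: measurable_funPTI.
  exists (W r @^-1` B); rewrite setDv; split; [|exact: negligible_set0..].
  by apply: sub_sigma_algebra; exists r, B.
split=> //; exists set0; rewrite setD0 set0D; split.
- by have [] := smallest_sigma_algebra setT (past s).
- by exists A; split.
- exact: negligible_set0.
Qed.

Lemma measurable_increment s t : measurable_fun setT (increment W s t).
Proof. by apply: measurable_funB. Qed.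

Lemma increment_independent s t (A : set Omega) (B : set R) :
  0 <= s -> s < t -> t <= T -> natural_filtration W s A -> measurable B ->
  (P (A `&` increment W s t @^-1` B) = P A * P (increment W s t @^-1` B))%E.
Proof.
move=> s0 st tT /natural_filtration_approx[mA [A' [pA n1 n2]]] mB.
have [_ _ _ ind] := W_brownian.
have mA' := past_measurable2 pA.
have mI : measurable (increment W s t @^-1` B).
  by rewrite -[X in measurable X]setTI; exact: measurable_increment.
rewrite (negligible_symdiff_measure mA mA')// -ind//.
apply: negligible_symdiff_measure.
- exact: measurableI.
- exact: measurableI.
- by apply: negligibleS n1 => x [[Ax Ix] n]; split=> // A'x; apply: n.
- by apply: negligibleS n2 => x [[Ax Ix] n]; split=> // A'x; apply: n.
Qed.

End BrownianIncrements.

Section HasIntegral.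
Context d (Omega : measurableType d) (R : realType) (mu : {measure set Omega -> \bar R}).

(** Integrability travels with the value, so that long sums of moments can be added term by term. *)
Definition has_integral (f : Omega -> R) (m : R) : Prop :=
  mu.-integrable setT (EFin \o f) /\ Rintegral mu setT f = m.

Lemma has_integralD f g m n : has_integral f m -> has_integral g n ->
  has_integral (fun w => f w + g w) (m + n).
Proof.
move=> [fi <-] [gi <-]; split; last by rewrite RintegralD.
by rewrite (_ : _ \o _ = (EFin \o f) \+ (EFin \o g))%E//; exact: integrableD.
Qed.

Lemma has_integral0 : has_integral (fun=> 0) 0.
Proof.
split; first exact: integrable0.
by rewrite /Rintegral integral0.
Qed.

Lemma has_integral_sum n (F : 'I_n -> Omega -> R) (m : 'I_n -> R) :
  (forall i, has_integral (F i) (m i)) ->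
  has_integral (fun w => \sum_(i < n) F i w) (\sum_(i < n) m i).
Proof.
elim: n F m => [|n ih] F m h.
  rewrite big_ord0 (_ : (fun w => _) = fun=> 0); first exact: has_integral0.
  by apply/funext => w; rewrite big_ord0.
rewrite big_ord_recr/= (_ : (fun w => _) = fun w =>
    (\sum_(i < n) F (widen_ord (leqnSn n) i) w) + F ord_max w).
  by apply: has_integralD (h _); apply: (ih (fun i => F (widen_ord (leqnSn n) i))).
by apply/funext => w; rewrite big_ord_recr.
Qed.

Lemma has_integralE f m : has_integral f m -> (\int[mu]_w (f w)%:E = m%:E)%E.
Proof.
move=> [fi <-]; rewrite /Rintegral fineK//; apply: integrable_fin_num => //; exact: fi.
Qed.

Lemma has_integral_of f (m : R) : mu.-integrable setT (EFin \o f) ->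
  (\int[mu]_w (f w)%:E = m%:E)%E -> has_integral f m.
Proof. by move=> fi e; split=> //; rewrite /Rintegral e. Qed.

End HasIntegral.

Section IncrementMoments.
Context d (Omega : measurableType d) (R : realType) (P : probability Omega R).
Context (T : R) (W : R -> {RV P >-> R}) (W_brownian : brownian_motion T W).

Local Notation F := (natural_filtration W).
Local Notation inc := (increment W).
Local Notation mean := (has_integral P).
Local Notation kappa := (normal_square R).

Lemma measurable_wrtP s (f : Omega -> R) : measurable_wrt (F s) f <->
  measurable_fun setT (f : g_sigma_algebraType (F s) -> R).
Proof.
split=> [h _ B mB|h B mB]; first by rewrite setTI; apply: sub_sigma_algebra; exact: h.
have := h measurableT B mB; rewrite setTI /measurable/=.
by rewrite (sigma_algebra_id (smallest_sigma_algebra _ _)).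
Qed.

Lemma measurable_wrt_fun s (f : Omega -> R) : measurable_wrt (F s) f -> measurable_fun setT f.
Proof.
by move=> h _ B mB; rewrite setTI; apply: natural_filtration_measurable; exact: h.
Qed.

Lemma measurable_wrt_le s t (f : Omega -> R) : s <= t ->
  measurable_wrt (F s) f -> measurable_wrt (F t) f.
Proof. by move=> st h B mB; apply: natural_filtration_sub st _ _; exact: h. Qed.

Lemma measurable_wrtM s (f g : Omega -> R) : measurable_wrt (F s) f ->
  measurable_wrt (F s) g -> measurable_wrt (F s) (fun w => f w * g w).
Proof. by move=> /measurable_wrtP mf /measurable_wrtP mg; apply/measurable_wrtP;
    exact: measurable_funM. Qed.

Lemma measurable_wrt_increment r s t : 0 <= r -> r <= s -> s <= t ->
  measurable_wrt (F t) (inc r s).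
Proof.
move=> r0 rs st.
have mW u : 0 <= u -> u <= t -> measurable_wrt (F t) (W u).
  move=> u0 ut B mB; apply: sub_sigma_algebra; left; exists u, B; split=> //.
  by rewrite u0 ut.
apply/measurable_wrtP; apply: measurable_funB; apply/measurable_wrtP; apply: mW => //.
- exact: le_trans rs.
- exact: le_trans st.
Qed.

Let increment_law s t (h : R -> \bar R) : 0 <= s -> s < t -> t <= T ->
  measurable_fun setT h -> (forall x, 0 <= h x)%E ->
  (\int[P]_w h (inc s t w) = \int[normal_prob 0 (Num.sqrt (t - s))]_x h x)%E.
Proof.
move=> s0 st tT mh h0; have [_ _ law _] := W_brownian.
rewrite (_ : [set: Omega] = (inc s t : _ -> measurableTypeR R) @^-1` [set: R])//.
rewrite -ge0_integral_pushforward//=; last exact: measurable_increment.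
apply: eq_measure_integral; first exact: measurable_increment.
by move=> mI A mA _; exact: law.
Qed.

Lemma increment_square s t : 0 <= s -> s <= t -> t <= T ->
  mean (fun w => inc s t w ^+ 2) (kappa * (t - s)).
Proof.
move=> s0; rewrite le_eqVlt => /orP[/eqP <-|st] tT.
  rewrite subrr mulr0 (_ : (fun w => _) = fun=> 0); first exact: has_integral0.
  by apply/funext => w; rewrite /increment subrr expr0n.
have E : (\int[P]_w (inc s t w ^+ 2)%:E = (kappa * (t - s))%:E)%E.
  rewrite (increment_law (h := fun x => (x ^+ 2)%:E)) //.
  - by rewrite normal_second_moment ?sqrtr_gt0 ?subr_gt0// sqr_sqrtr// subr_ge0 ltW.
  - by apply/measurable_EFinP; exact: measurable_funX.
  - by move=> x; rewrite lee_fin sqr_ge0.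
apply: has_integral_of => //; apply/integrableP; split.
  by apply/measurable_EFinP; apply: measurable_funX; exact: measurable_increment.
rewrite (eq_integral (fun w => (inc s t w ^+ 2)%:E)) ?E ?ltry// => w _.
by rewrite gee0_abs//= lee_fin sqr_ge0.
Qed.

(** The square dominates: |x| <= 1 + x^2 gives integrability. By symmetry of the law the positive
    and negative parts have equal integrals. *)
Lemma increment_mean s t : 0 <= s -> s <= t -> t <= T -> mean (inc s t) 0.
Proof.
move=> s0; rewrite le_eqVlt => /orP[/eqP <-|st] tT.
  rewrite (_ : inc s s = fun=> 0); first exact: has_integral0.
  by apply/funext => w; rewrite /increment subrr.
have mI := measurable_increment W s t.
have [sqi _] := increment_square s0 (ltW st) tT.
have Ii : P.-integrable setT (EFin \o inc s t).
  apply: (@le_integrable _ _ _ P setT measurableT _ (fun w => (1 + inc s t w ^+ 2)%:E)).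
  - exact/measurable_EFinP.
  - move=> w _; rewrite !abse_EFin lee_fin (ger0_norm (addr_ge0 _ (sqr_ge0 _)))//.
    rewrite -[inc s t w ^+ 2]real_normK ?num_real//.
    by have := sqr_ge0 (`|inc s t w| - 1); have := normr_ge0 (inc s t w); nra.
  - rewrite (_ : (fun w => _) = (cst 1%E \+ (fun w => (inc s t w ^+ 2)%:E))%E)//.
    by apply: integrableD => //; exact: finite_measure_integrable_cst.
apply: has_integral_of => //; rewrite integralE.
rewrite (_ : integral _ _ ((fun w => (inc s t w)%:E)^\-) = integral P setT ((fun w =>
    (inc s t w)%:E)^\+))%E.
  rewrite subee// (_ : integral _ _ _ = \int[P]_w ((EFin \o inc s t)^\+ w))%E//.
  by apply: integrable_fin_num => //; exact: integrable_funepos.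
rewrite (eq_integral (fun w => maxe (- (inc s t w)%:E)%E 0%E)); last by move=> w _;
    rewrite funenegE.
rewrite [RHS](eq_integral (fun w => maxe (inc s t w)%:E 0%E)); last by move=> w _; rewrite funeposE.
rewrite (increment_law (h := fun x => maxe (- x%:E)%E 0%E))//; last 2 first.
- by apply: measurable_maxe => //; apply: measurableT_comp.
- by move=> x; rewrite le_max lexx orbT.
rewrite (increment_law (h := fun x => maxe x%:E 0%E))//; last 2 first.
- by apply: measurable_maxe => //; exact/measurable_EFinP.
- by move=> x; rewrite le_max lexx orbT.
rewrite -(@normal_symmetric _ _ (fun x => maxe x%:E 0%E))//.
- by rewrite gt_eqF// sqrtr_gt0 subr_gt0.
- by apply: measurable_maxe => //; exact/measurable_EFinP.
- by move=> x; rewrite le_max lexx orbT.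
Qed.

(** [g] will be the identity or the square. The condition [g 0 = 0] settles [s = t], a case on which
    the law of increments in [brownian_motion] is silent. *)
Let increment_times g s t (f : Omega -> R) m : measurable_fun setT g ->
  0 <= s -> s <= t -> t <= T -> measurable_wrt (F s) f ->
  P.-integrable setT (EFin \o f) -> mean (fun w => g (inc s t w)) m ->
  g 0 = 0 ->
  mean (fun w => f w * g (inc s t w)) (Rintegral P setT f * m).
Proof.
move=> mg s0 st tT mf fi [gi gm] g0; move: st; rewrite le_eqVlt => /orP[/eqP st|st].
  have z w : g (inc s t w) = 0 by rewrite /increment st subrr.
  have -> : m = 0.
    rewrite -gm (_ : (fun w => _) = fun=> 0); last exact/funext.
    by rewrite /Rintegral integral0.
  rewrite mulr0 (_ : (fun w => _) = fun=> 0); first exact: has_integral0.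
  by apply/funext => w; rewrite z mulr0.
have mf' := measurable_wrt_fun mf.
have [] := @independent_expectation _ _ _ P f (inc s t) g mf' (measurable_increment W s t) mg _
    fi gi.
  by move=> A B mA mB; apply: (increment_independent W_brownian s0 st tT _ mB); exact: mf.
move=> i e; apply: has_integral_of => //; rewrite e EFinM -gm /Rintegral !fineK//.
- by apply: integrable_fin_num => //; exact: gi.
- by apply: integrable_fin_num => //; exact: fi.
Qed.

Lemma increment_centered s t f : 0 <= s -> s <= t -> t <= T -> measurable_wrt (F s) f ->
  P.-integrable setT (EFin \o f) -> mean (fun w => f w * inc s t w) 0.
Proof.
move=> s0 st tT mf fi; rewrite -(mulr0 (Rintegral P setT f)).
by apply: (increment_times (g := id)) => //; exact: increment_mean.
Qed.

Lemma increment_variance s t f : 0 <= s -> s <= t -> t <= T -> measurable_wrt (F s) f ->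
  P.-integrable setT (EFin \o f) ->
  mean (fun w => f w * inc s t w ^+ 2) (kappa * (t - s) * Rintegral P setT f).
Proof.
move=> s0 st tT mf fi; rewrite mulrC.
apply: (increment_times (g := fun x => x ^+ 2)) => //.
- exact: increment_square.
- by rewrite expr0n.
Qed.

(** The length of the intersection of ]a, b] and ]a', b']. *)
Definition overlap (a b a' b' : R) : R := Num.max 0 (Num.min b b' - Num.max a a').

(* Cut both intervals at [a'] and [c = min b b']: on the common part ]a', c] the increment is
   squared, and every other product has a factor that is independent of the rest and centered. *)
Lemma increment_product_le a b a' b' f :
  0 <= a -> a <= b -> b <= T -> a' <= b' -> b' <= T -> a <= a' ->
  measurable_wrt (F a') f -> P.-integrable setT (EFin \o f) ->
  P.-integrable setT (EFin \o (fun w => f w * inc a (Num.min b a') w)) ->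
  mean (fun w => f w * (inc a b w * inc a' b' w))
    (kappa * overlap a b a' b' * Rintegral P setT f).
Proof.
move=> a0 ab bT ab' bT' aa mf fi pi.
have a0' : 0 <= a' by exact: le_trans aa.
rewrite /overlap (max_idPr aa).
have [ba|ba] := leP b a'.
  (* Disjoint intervals: the first increment is known at time [a'], and the second is centered given
     that past. *)
  rewrite (max_idPl _); last by rewrite subr_le0 (le_trans _ ba)// ge_min lexx.
  rewrite mulr0 mul0r.
  rewrite (_ : (fun w => _) = fun w => (f w * inc a b w) * inc a' b' w); last first.
    by apply/funext => w; rewrite mulrA.
  apply: increment_centered => //.
    apply: measurable_wrtM => //; exact: measurable_wrt_increment.
  by rewrite (min_idPl ba) in pi.
rewrite (min_idPr (ltW ba)) in pi.
set c := Num.min b b'.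
have ac : a' <= c by rewrite le_min (ltW ba) ab'.
have cT : c <= T by rewrite ge_min bT.
have cb : c <= b by rewrite ge_min lexx.
have cb' : c <= b' by rewrite ge_min lexx orbT.
have c0 : 0 <= c by exact: le_trans ac.
rewrite (max_idPr _) ?subr_ge0//.
(* [c] is the right end of one of the intervals, so one of the two remainders is empty. This is the
   sixth product of the expansion; [m1] to [m5] are the others. *)
have rr w : inc c b w * inc c b' w = 0.
  by rewrite /c; have [h|h] := leP b b'; rewrite /increment ?(subrr, mul0r, mulr0).
have mp : measurable_wrt (F a') (fun w => f w * inc a a' w).
  by apply: measurable_wrtM => //; exact: measurable_wrt_increment.
have mfq : measurable_wrt (F c) (fun w => f w * inc a' c w).
  apply: measurable_wrtM; last exact: measurable_wrt_increment.
  exact: measurable_wrt_le mf.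
have [qi _] := increment_centered a0' ac cT mf fi.
have m1 := increment_centered a0' ac cT mp pi.
have m2 := increment_centered c0 cb' bT' (measurable_wrt_le ac mp) pi.
have m3 := increment_variance a0' ac cT mf fi.
have m4 := increment_centered c0 cb' bT' mfq qi.
have m5 := increment_centered c0 cb bT mfq qi.
have := has_integralD (has_integralD m1 m2) (has_integralD m3 (has_integralD m4 m5)).
rewrite !addr0 add0r; congr (mean _ _); apply/funext => w.
have := rr w; rewrite /increment.
set p := W a w; set q := W a' w; set r := W c w; set s := W b w; set t := W b' w => h.
apply/eqP; rewrite -subr_eq0 -(mulr0 (- f w)) -h; apply/eqP; ring.
Qed.

End IncrementMoments.

Lemma bounded_mul_integrable d (X : measurableType d) (R : realType)
    (mu : {measure set X -> \bar R}) (D : set X) (mD : measurable D) (f g : X -> R) (M : R) :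
  measurable_fun D f -> (forall x, D x -> `|f x| <= M) -> mu.-integrable D (EFin \o g) ->
  mu.-integrable D (fun x => (f x * g x)%:E).
Proof.
move=> mf fM gi; apply: (@le_integrable _ _ _ mu D mD _ (fun x => M%:E * (EFin \o g) x)%E).
- by apply/measurable_EFinP; apply: measurable_funM => //; apply/measurable_EFinP;
    exact: measurable_int gi.
- move=> x Dx; rewrite abseM !abse_EFin -EFinM lee_fin normrM.
  by rewrite ler_wpM2r//; apply: le_trans (fM x Dx) (ler_norm _).
- exact: integrableZl.
Qed.

(** * Ito integrals *)

Section SimpleIsometry.
Context d (Omega : measurableType d) (R : realType) (P : probability Omega R).
Context (T : R) (W : R -> {RV P >-> R}) (W_brownian : brownian_motion T W).

Local Notation F := (natural_filtration W).
Local Notation inc := (increment W).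
Local Notation mean := (has_integral P).
Local Notation kappa := (normal_square R).
Local Notation space := (measurableTypeR R * Omega)%type.

Let bounded_prod (f g : Omega -> R) : (exists M : R, forall w, `|f w| <= M) ->
  (exists M : R, forall w, `|g w| <= M) -> exists M : R, forall w, `|f w * g w| <= M.
Proof.
by move=> [M fM] [N gN]; exists (M * N) => w; rewrite normrM ler_pM.
Qed.

Let bounded_integrable (f : Omega -> R) : measurable_fun setT f ->
  (exists M : R, forall w, `|f w| <= M) -> P.-integrable setT (EFin \o f).
Proof.
move=> mf [M fM]; have -> : EFin \o f = fun w => (f w * cst 1 w)%:E.
  by apply/funext => w; rewrite /= mulr1.
apply: (bounded_mul_integrable measurableT mf (fun w _ => fM w)).
exact: finite_measure_integrable_cst.
Qed.

Lemma increment_product (a b a' b' : R) (f f' : Omega -> R) :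
  0 <= a -> a <= b -> b <= T -> 0 <= a' -> a' <= b' -> b' <= T ->
  measurable_wrt (F a) f -> measurable_wrt (F a') f' ->
  (exists M : R, forall w, `|f w| <= M) -> (exists M : R, forall w, `|f' w| <= M) ->
  mean (fun w => (f w * inc a b w) * (f' w * inc a' b' w))
    (kappa * (overlap a b a' b' * Rintegral P setT (fun w => f w * f' w))).
Proof.
wlog aa : a b a' b' f f' / a <= a'.
  move=> h a0 ab bT a0' ab' bT' mf mf' bf bf'.
  have [aa|/ltW aa] := leP a a'; first exact: h.
  have := h a' b' a b f' f aa a0' ab' bT' a0 ab bT mf' mf bf' bf.
  rewrite /overlap (minC b') (maxC a').
  have -> : (fun w => f' w * f w) = (fun w => f w * f' w).
    by apply/funext => w; rewrite mulrC.
  by congr (mean _ _); apply/funext => w; rewrite mulrC.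
move=> a0 ab bT a0' ab' bT' mf mf' bf bf'.
have mff : measurable_wrt (F a') (fun w => f w * f' w).
  by apply: measurable_wrtM => //; exact: measurable_wrt_le mf.
have bff := bounded_prod bf bf'.
have iff := bounded_integrable (measurable_wrt_fun mff) bff.
have [M ffM] := bff.
have := @increment_product_le _ _ _ P T W W_brownian a b a' b' (fun w =>
    f w * f' w) a0 ab bT ab' bT' aa mff iff.
rewrite mulrA; have -> : (fun w => f w * f' w * (inc a b w * inc a' b' w)) =
    (fun w => (f w * inc a b w) * (f' w * inc a' b' w)).
  by apply/funext => w; ring.
apply; apply: (bounded_mul_integrable measurableT (measurable_wrt_fun mff) (fun w _ => ffM w)).
have [] := increment_mean W_brownian a0 (_ : a <= Num.min b a') (_ : Num.min b a' <= T) => //.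
- by rewrite le_min ab.
- by rewrite ge_min bT.
Qed.

Lemma space_time_indicator (a b : R) (f : Omega -> R) : P.-integrable setT (EFin \o f) ->
  has_integral (space_time P)
    (fun z : space => f z.2 * ((a < z.1) && (z.1 <= b))%:R)
    (Num.max 0 (b - a) * Rintegral P setT f).
Proof.
move=> fi; pose I : set (measurableTypeR R) := `]a, b]%classic.
have mI : measurable I by exact: measurable_itv.
have lI : lebesgue_measure I = (Num.max 0 (b - a))%:E.
  rewrite /I lebesgue_measure_itv/= lte_fin; case: ltP => ab.
    by rewrite (max_idPr _)// subr_ge0 ltW.
  by rewrite (max_idPl _)// subr_le0.
pose h (z : space) : R := f z.2 * \1_I z.1.
have -> : (fun z : space => f z.2 * ((a < z.1) && (z.1 <= b))%:R) = h.
  apply/funext => z; rewrite /h indicE; congr (_ * (nat_of_bool _)%:R).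
  by apply/idP/idP; rewrite inE /I/= in_itv.
have mf : measurable_fun setT f by apply/measurable_EFinP; exact: measurable_int fi.
have mh : measurable_fun setT (EFin \o h).
  apply/measurable_EFinP; apply: measurable_funM.
    by apply: measurableT_comp => //; exact: measurable_snd.
  by apply: measurableT_comp; [exact: measurable_indic|exact: measurable_fst].
have ff : (\int[P]_w (f w)%:E)%E \is a fin_num by apply: integrable_fin_num => //; exact: fi.
have fa : (\int[P]_w `|(f w)%:E|)%E \is a fin_num.
  by rewrite ge0_fin_numE; [case/integrableP: fi|exact: integral_ge0].
have ih : (space_time P).-integrable setT (EFin \o h).
  apply/integrableP; split=> //.
  rewrite fubini_tonelli1//; last exact: measurableT_comp.
  rewrite (eq_integral (fun s => (\1_I s)%:E * \int[P]_w `|(f w)%:E|)%E); last first.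
    move=> s _; rewrite /fubini_F -ge0_integralZl//; last first.
      by do 2 apply: measurableT_comp => //.
    by apply: eq_integral => w _; rewrite /h/= normrM mulrC EFinM ger0_norm.
  rewrite -(fineK fa) ge0_integralZr//; last 2 first.
  - by apply/measurable_EFinP; exact: measurable_indic.
  - by rewrite lee_fin fine_ge0// integral_ge0.
  by rewrite integral_indic// setIT [X in (X * _)%E]lI ltry.
apply: has_integral_of => //.
rewrite -[LHS]integral12_prod_meas1//.
rewrite (eq_integral (fun s => (\1_I s)%:E * \int[P]_w (f w)%:E)%E); last first.
  move=> s _; rewrite /fubini_F -integralZl//.
  by apply: eq_integral => w _; rewrite /h/= mulrC EFinM.
rewrite -(fineK ff) integralZr//; last first.
  apply/integrableP; split; first by apply/measurable_EFinP; exact: measurable_indic.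
  rewrite (eq_integral (fun x => (\1_I x)%:E)).
    by rewrite integral_indic// setIT [X in (X < _)%E]lI ltry.
  by move=> x _; rewrite gee0_abs// lee_fin.
by rewrite integral_indic// setIT [X in (X * _)%E]lI.
Qed.

(* The intervals of [H] may overlap; the isometry holds for each pair of terms of the double sum,
   so that no refinement to disjoint intervals is needed. *)
Lemma simple_isometry (t : R) (H : simple_process Omega R) : t <= T -> simple_on W t H ->
  (\int[P]_w (simple_integral W H w ^+ 2)%:E =
   kappa%:E * \int[space_time P]_(z in time_domain t) (simple_val H z ^+ 2)%:E)%E.
Proof.
move=> tT Ht.
pose E (i j : 'I_(sp_size H)) := overlap (sp_left i) (sp_right i) (sp_left j) (sp_right j) *
  Rintegral P setT (fun w => sp_coef i w * sp_coef j w).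
have mm (i j : 'I_(sp_size H)) : measurable_wrt (F (Num.max (sp_left i) (sp_left j))) (fun w =>
    sp_coef i w * sp_coef j w).
  have [_ _ _ mi _] := Ht i; have [_ _ _ mj _] := Ht j.
  by apply: measurable_wrtM; [apply: measurable_wrt_le mi|apply: measurable_wrt_le mj];
    rewrite le_max lexx ?orbT.
have ii (i j : 'I_(sp_size H)) : P.-integrable setT (EFin \o (fun w => sp_coef i w * sp_coef j w)).
  have [_ _ _ _ bi] := Ht i; have [_ _ _ _ bj] := Ht j.
  by apply: bounded_integrable; [exact: measurable_wrt_fun (mm i j)|exact: bounded_prod].
have e1 : mean (fun w => simple_integral W H w ^+ 2) (kappa * \sum_i \sum_j E i j).
  have -> : (fun w => simple_integral W H w ^+ 2) = fun w =>
      \sum_(i < sp_size H) \sum_(j < sp_size H)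
      ((sp_coef i w * inc (sp_left i) (sp_right i) w) *
       (sp_coef j w * inc (sp_left j) (sp_right j) w)).
    apply/funext => w; rewrite expr2 /simple_integral mulr_suml.
    by apply: eq_bigr => i _; rewrite mulr_sumr.
  rewrite mulr_sumr; apply: has_integral_sum => i.
  rewrite mulr_sumr; apply: has_integral_sum => j.
  have [? ? hi ? ?] := Ht i; have [? ? hj ? ?] := Ht j.
  by apply: increment_product => //; [exact: le_trans hi tT|exact: le_trans hj tT].
(* The product of two indicators is the indicator of ]max, min], of length [overlap]; the same
   double sum appears as in [e1]. *)
have e2 : has_integral (space_time P) (fun z => simple_val H z ^+ 2) (\sum_i \sum_j E i j).
  have -> : (fun z => simple_val H z ^+ 2) = fun z => \sum_(i < sp_size H) \sum_(j < sp_size H)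
      ((sp_coef i z.2 * sp_coef j z.2) *
       ((Num.max (sp_left i) (sp_left j) < z.1) && (z.1 <= Num.min (sp_right i) (sp_right j)))%:R).
    apply/funext => z; rewrite expr2 /simple_val mulr_suml.
    apply: eq_bigr => i _; rewrite mulr_sumr; apply: eq_bigr => j _.
    rewrite gt_max le_min mulrACA -natrM mulnb; congr (_ * _%:R).
    by rewrite andbACA.
  apply: has_integral_sum => i; apply: has_integral_sum => j.
  exact: (space_time_indicator _ _ (ii i j)).
rewrite (has_integralE e1) EFinM -(has_integralE e2); congr (_ * _)%E.
(* All intervals lie in [0, t], so the integrand vanishes off [time_domain t]. *)
rewrite [RHS]integral_mkcond; apply: eq_integral => z _.
rewrite patchE; case: ifPn => // /negP zD; rewrite /simple_val big1 ?expr0n// => i _.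
have [a0 _ bt _ _] := Ht i.
case: (boolP (_ && _)) => [/andP[az zb]|_]; last by rewrite mulr0.
case: zD; rewrite inE; split=> //=.
by rewrite in_itv/= (le_trans a0 (ltW az)) (le_trans zb).
Qed.

End SimpleIsometry.

Lemma cvge0Z (R : realType) (a : R) (u : nat -> \bar R) :
  u n @[n --> \oo] --> 0%E -> (a%:E * u n)%E @[n --> \oo] --> 0%E.
Proof. by move=> u0; rewrite -[X in _ --> X](mule0 a%:E); apply: cvgeZl. Qed.

Lemma cvge0D (R : realType) (a b : R) (u v : nat -> \bar R) :
  u n @[n --> \oo] --> 0%E -> v n @[n --> \oo] --> 0%E ->
  (a%:E * u n + b%:E * v n)%E @[n --> \oo] --> 0%E.
Proof.
move=> u0 v0; rewrite -[X in _ --> X](adde0 0%E).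
by apply: cvgeD => //; exact: cvge0Z.
Qed.

Lemma cvge0_squeeze (R : realType) (u v : nat -> \bar R) :
  (forall n, 0 <= u n)%E -> (forall n, u n <= v n)%E -> v n @[n --> \oo] --> 0%E ->
  u n @[n --> \oo] --> 0%E.
Proof.
move=> u0 uv v0; apply: (@squeeze_cvge _ _ _ _ (cst 0%E) u v) => //; last exact: cvg_cst.
by apply: nearW => n; rewrite u0 uv.
Qed.

Lemma integral_sqrD_le d (X : measurableType d) (R : realType)
    (mu : {measure set X -> \bar R}) (D : set X) (mD : measurable D) (f g : X -> R) :
  measurable_fun D f -> measurable_fun D g ->
  (\int[mu]_(x in D) ((f x + g x) ^+ 2)%:E <=
   2%:E * \int[mu]_(x in D) (f x ^+ 2)%:E + 2%:E * \int[mu]_(x in D) (g x ^+ 2)%:E)%E.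
Proof.
move=> mf mg.
have msq (h : X -> R) : measurable_fun D h -> measurable_fun D (fun x => (h x ^+ 2)%:E).
  by move=> mh; apply/measurable_EFinP; exact: measurable_funX.
have sq0 (h : X -> R) x : D x -> (0 <= (h x ^+ 2)%:E)%E by rewrite lee_fin sqr_ge0.
rewrite -!ge0_integralZl//; do ?[exact: msq|by move=> x Dx; exact: sq0].
rewrite -ge0_integralD//; last 4 first.
- by move=> x Dx; rewrite mule_ge0 ?sq0.
- by apply: emeasurable_funM; [exact: measurable_cst|exact: msq].
- by move=> x Dx; rewrite mule_ge0 ?sq0.
- by apply: emeasurable_funM; [exact: measurable_cst|exact: msq].
apply: ge0_le_integral => //.
- by move=> x Dx; apply: (sq0 (fun x => f x + g x)).
- by apply: msq; exact: measurable_funD.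
- by apply: emeasurable_funD; apply: emeasurable_funM;
    [exact: measurable_cst|exact: msq|exact: measurable_cst|exact: msq].
- move=> x _; rewrite -!EFinM -EFinD lee_fin.
  by have := sqr_ge0 (f x - g x); nra.
Qed.

(** * Uniqueness and additivity of the Ito integral *)

Section ItoIntegral.
Context d (Omega : measurableType d) (R : realType) (P : probability Omega R).
Context (T : R) (W : R -> {RV P >-> R}) (W_brownian : brownian_motion T W).

Local Notation F := (natural_filtration W).
Local Notation kappa := (normal_square R).
Local Notation space := (measurableTypeR R * Omega)%type.
Implicit Types (H K : simple_process Omega R) (t : R).

(** The process [H + a K], obtained by concatenating the two families of intervals. *)
Definition simple_combine (a : R) H K : simple_process Omega R :=
  @SimpleProcess d Omega R (sp_size H + sp_size K)
    (fun i => match fintype.split i with inl j => sp_left j | inr k => sp_left k end)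
    (fun i => match fintype.split i with inl j => sp_right j | inr k => sp_right k end)
    (fun i => match fintype.split i with
      inl j => sp_coef j | inr k => fun w => a * sp_coef k w end).

Lemma simple_combine_on a t H K : simple_on W t H -> simple_on W t K ->
  simple_on W t (simple_combine a H K).
Proof.
move=> Ht Kt i; rewrite /simple_combine/=; case: (fintype.split i) => j; first exact: Ht.
have [k1 k2 k3 k4 [M k5]] := Kt j; split=> //.
  apply: measurable_wrtM => //.
  by apply/measurable_wrtP; exact: measurable_cst.
by exists (`|a| * M) => w; rewrite normrM ler_wpM2l.
Qed.

Let splitl m n (i : 'I_m) : fintype.split (lshift n i) = inl i.
Proof. exact: (unsplitK (inl i)). Qed.
Let splitr m n (i : 'I_n) : fintype.split (rshift m i) = inr i.
Proof. exact: (unsplitK (inr i)). Qed.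

Lemma simple_val_combine a H K z :
  simple_val (simple_combine a H K) z = simple_val H z + a * simple_val K z.
Proof.
rewrite /simple_val/= big_split_ord/=; congr (_ + _).
  by apply: eq_bigr => i _; rewrite splitl.
by rewrite mulr_sumr; apply: eq_bigr => i _; rewrite splitr mulrA.
Qed.

Lemma simple_integral_combine a H K w :
  simple_integral W (simple_combine a H K) w =
  simple_integral W H w + a * simple_integral W K w.
Proof.
rewrite /simple_integral/= big_split_ord/=; congr (_ + _).
  by apply: eq_bigr => i _; rewrite splitl.
by rewrite mulr_sumr; apply: eq_bigr => i _; rewrite splitr mulrA.
Qed.

Lemma measurable_simple_val t H : simple_on W t H -> measurable_fun setT (simple_val H : space ->
    R).
Proof.
move=> Ht; apply: measurable_sum => i; have [_ _ _ mi _] := Ht i.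
apply: measurable_funM.
  by apply: measurableT_comp; [exact: measurable_wrt_fun mi|exact: measurable_snd].
rewrite (_ : (fun z : space => _) = \1_(`]sp_left i,
    sp_right i]%classic : set (measurableTypeR R)) \o fst).
  by apply: measurableT_comp; [exact: measurable_indic|exact: measurable_fst].
apply/funext => z; rewrite /= indicE; congr (nat_of_bool _)%:R.
by apply/idP/idP; rewrite inE /= in_itv.
Qed.

Lemma measurable_simple_integral t H : simple_on W t H -> measurable_fun setT (simple_integral W H).
Proof.
move=> Ht; apply: measurable_sum => i; have [_ _ _ mi _] := Ht i.
by apply: measurable_funM; [exact: measurable_wrt_fun mi|exact: measurable_increment].
Qed.

(** Two approximating sequences are both close to [s], hence to each other; the isometry brings
    their integrals together, and these are close to [I] and [J]. *)
Lemma ito_integral_unique t (s : space -> R) (I J : Omega -> R) : t <= T ->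
  is_ito_integral W t s I -> is_ito_integral W t s J -> {ae P, forall w, I w = J w}.
Proof.
move=> tT [[ms _] mI [H [Ht Hs HI]]] [_ mJ [K [Kt Ks KJ]]].
have mD := measurable_time_domain (Omega := Omega) t.
suff : (\int[P]_w ((I w - J w) ^+ 2)%:E)%E = 0%E.
  move=> /(integral_square_eq0 measurableT (measurable_funB mI mJ)).
  by apply: filterS => w /(_ Logic.I) /eqP; rewrite subr_eq0 => /eqP.
apply/eqP; rewrite eq_le; apply/andP; split; last first.
  by apply: integral_ge0 => w _; rewrite lee_fin sqr_ge0.
have mHI n : measurable_fun setT (fun w => simple_integral W (H n) w - I w).
  by apply: measurable_funB => //; exact: measurable_simple_integral (Ht n).
have mKJ n : measurable_fun setT (fun w => simple_integral W (K n) w - J w).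
  by apply: measurable_funB => //; exact: measurable_simple_integral (Kt n).
(* [L n] is [K n - H n], the process to which the isometry is applied. *)
pose L n := simple_combine (- 1) (K n) (H n).
have Lt n : simple_on W t (L n) by exact: simple_combine_on.
have mHs n : measurable_fun (time_domain t) (fun z : space => simple_val (H n) z - s z).
  apply: measurable_funB => //; apply: measurable_funTS; exact: measurable_simple_val (Ht n).
have mKs n : measurable_fun (time_domain t) (fun z : space => simple_val (K n) z - s z).
  apply: measurable_funB => //; apply: measurable_funTS; exact: measurable_simple_val (Kt n).
pose a n := (\int[space_time P]_(z in time_domain t) ((simple_val (H n) z - s z) ^+ 2)%:E)%E.
pose b n := (\int[space_time P]_(z in time_domain t) ((simple_val (K n) z - s z) ^+ 2)%:E)%E.
pose p n := (\int[P]_w ((simple_integral W (H n) w - I w) ^+ 2)%:E)%E.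
pose q n := (\int[P]_w ((simple_integral W (K n) w - J w) ^+ 2)%:E)%E.
have Lab n : (\int[P]_w (simple_integral W (L n) w ^+ 2)%:E <=
    kappa%:E * (2%:E * b n + 2%:E * a n))%E.
  rewrite (simple_isometry W_brownian tT (Lt n)); apply: lee_wpmul2l.
    by rewrite lee_fin fine_ge0// integral_ge0// => x _; rewrite lee_fin sqr_ge0.
  rewrite (eq_integral (fun z =>
      ((simple_val (K n) z - s z + (- (simple_val (H n) z - s z))) ^+ 2)%:E)).
    apply: le_trans (integral_sqrD_le _ mD _ _) _ => //.
      by apply: measurableT_comp; [exact: oppr_measurable|exact: mHs n].
    by rewrite /a /b; under [X in (_ + _ * X)%E]eq_integral do rewrite sqrrN.
  by move=> z _; rewrite simple_val_combine; congr (_ ^+ 2)%:E; ring.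
have IJ n : (\int[P]_w ((I w - J w) ^+ 2)%:E <=
    2%:E * (2%:E * p n + 2%:E * q n) + 2%:E * (kappa%:E * (2%:E * b n + 2%:E * a n)))%E.
  rewrite (eq_integral (fun w =>
      (((simple_integral W (K n) w - J w - (simple_integral W (H n) w - I w)) +
      (- simple_integral W (L n) w)) ^+ 2)%:E)); last first.
    by move=> w _; rewrite simple_integral_combine; congr (_ ^+ 2)%:E; ring.
  apply: le_trans (integral_sqrD_le _ measurableT _ _) _.
  - exact: measurable_funB.
  - by apply: measurableT_comp; [exact: oppr_measurable|exact: measurable_simple_integral (Lt n)].
  apply: leeD; apply: lee_wpmul2l; rewrite ?lee_fin//.
    rewrite addeC; apply: le_trans (integral_sqrD_le _ measurableT _ _) _ => //.
      by apply: measurableT_comp; [exact: oppr_measurable|exact: mHI n].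
    by rewrite /p /q; under [X in (_ + _ * X)%E]eq_integral do rewrite sqrrN.
  by under eq_integral do rewrite sqrrN; exact: Lab.
have : (2%:E * (2%:E * p n + 2%:E * q n) + 2%:E * (kappa%:E * (2%:E * b n + 2%:E *
    a n)))%E @[n --> \oo] --> 0%E.
  by apply: cvge0D; [exact: cvge0D|apply: cvge0Z; exact: cvge0D].
by move=> h; rewrite -(cvg_lim _ h)//; apply: lime_ge; [apply/cvg_ex; eexists;
    exact: h|exact: nearW].
Qed.

Lemma ito_integralD t (s s' : space -> R) (I J : Omega -> R) :
  is_ito_integral W t s I -> is_ito_integral W t s' J ->
  is_ito_integral W t (fun z => s z + s' z) (fun w => I w + J w).
Proof.
move=> [[ms as_] mI [H [Ht Hs HI]]] [[ms' as'] mJ [K [Kt Ks KJ]]].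
have mD := measurable_time_domain (Omega := Omega) t.
split.
- split; first exact: measurable_funD.
  move=> r rt; apply/measurable_wrtP; apply: measurable_funD; apply/measurable_wrtP;
      [exact: as_|exact: as'].
- exact: measurable_funD.
exists (fun n => simple_combine 1 (H n) (K n)); split.
- by move=> n; exact: simple_combine_on.
- apply: cvge0_squeeze (cvge0D 2 2 Hs Ks) => n.
    by apply: integral_ge0 => z _; rewrite lee_fin sqr_ge0.
  rewrite (eq_integral (fun z =>
      (((simple_val (H n) z - s z) + (simple_val (K n) z - s' z)) ^+ 2)%:E)).
    apply: integral_sqrD_le => //.
      by apply: measurable_funB => //; apply: measurable_funTS; exact: measurable_simple_val (Ht n).
    by apply: measurable_funB => //; apply: measurable_funTS; exact: measurable_simple_val (Kt n).
  by move=> z _; rewrite simple_val_combine; congr (_ ^+ 2)%:E; ring.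
- apply: cvge0_squeeze (cvge0D 2 2 HI KJ) => n.
    by apply: integral_ge0 => z _; rewrite lee_fin sqr_ge0.
  rewrite (eq_integral (fun w =>
      (((simple_integral W (H n) w - I w) + (simple_integral W (K n) w - J w)) ^+ 2)%:E)).
    apply: integral_sqrD_le => //.
      by apply: measurable_funB => //; exact: measurable_simple_integral (Ht n).
    by apply: measurable_funB => //; exact: measurable_simple_integral (Kt n).
  by move=> z _; rewrite simple_integral_combine; congr (_ ^+ 2)%:E; ring.
Qed.

End ItoIntegral.

(** * The state equation *)

Section SpaceTime.
Context d (Omega : measurableType d) (R : realType) (P : probability Omega R) (T : R).
Local Notation space := (measurableTypeR R * Omega)%type.
Local Notation D := (time_domain (Omega := Omega) T).
Local Notation mu := (@lebesgue_measure R).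

Let mD : measurable D := measurable_time_domain (Omega := Omega) T.

(** Fubini for null sets. It links equality in [L2F], almost everywhere on space-time, to the state
    equation, which holds almost surely for almost every [t]. *)
Lemma ae_space_time_eq (f g : space -> R) :
  measurable_fun D f -> measurable_fun D g ->
  {ae space_time P, forall z, D z -> f z = g z} <->
  {ae mu, forall t : R, 0 <= t <= T -> {ae P, forall w, f (t, w) = g (t, w)}}.
Proof.
move=> mf mg; pose N := D `&` [set z | f z != g z].
have mN : measurable N.
  have := @measurable_neqe _ _ R D mD (EFin \o f) (EFin \o g).
  by apply; exact/measurable_EFinP.
have mNt t : measurable (xsection N t) by exact: measurable_xsection.
have Nt t : 0 <= t <= T -> P (xsection N t) = 0%E <-> {ae P, forall w, f (t, w) = g (t, w)}.
  move=> t0; rewrite -(negligibleP P (mNt t)); split=> h.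
    apply: negligibleS h => w /= fg; rewrite /xsection/= inE; split; first by split;
        rewrite //= in_itv.
    by apply/eqP.
  by apply: negligibleS h => w; rewrite /xsection/= inE => -[_ /eqP].
have NN : {ae space_time P, forall z, D z -> f z = g z} <-> space_time P N = 0%E.
  rewrite -(negligibleP _ mN); split=> h.
    by apply: negligibleS h => z [Dz /eqP fg] /(_ Dz).
  apply: negligibleS h => z /= /not_implyP[Dz fg]; split=> //; exact/eqP.
rewrite {}NN.
have mP : measurable_fun setT (P \o xsection N) by exact: measurable_fun_xsection.
have -> : (space_time P N = 0)%E <-> ae_eq mu setT (P \o xsection N) (cst 0%E).
  rewrite -(ae_eq_integral_abs mu measurableT mP) -[space_time P N]/(\int[mu]_x (P \o xsection N)
      x)%E.
  have -> : (\int[mu]_x `|(P \o xsection N) x| = \int[mu]_x (P \o xsection N) x)%E.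
    by apply: eq_integral => x _; rewrite gee0_abs.
  by [].
split=> [|h].
  by apply: filterS => t /= h t0; apply/(Nt t t0); exact: h.
suff : {ae mu, forall t, setT t -> (P \o xsection N) t = cst 0%E t} by [].
move: h; apply: (filterS (F := almost_everywhere mu)) => t /= h _.
(* Outside [0, T] the section is empty, since [N] is contained in [D]. *)
have [t0|t0] := boolP (0 <= t <= T); first by apply/(Nt t t0); exact: h.
rewrite (_ : xsection N t = set0) ?measure0// -subset0 => w.
by rewrite /xsection/= inE => -[[/=]]; rewrite in_itv/= (negbTE t0).
Qed.

(** The drift is integrated path by path; splitting that integral over a sum requires integrability
    of almost every path. *)
Lemma integrable_path (t : R) (f : space -> R) : 0 <= t -> t <= T ->
  (space_time P).-integrable D (EFin \o f) ->
  {ae P, forall w, mu.-integrable `[0, t] (fun s => (f (s, w))%:E)}.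
Proof.
move=> t0 tT /(integrable_mkcond _ mD).1 /ae_integrable2; apply: filterS => w h.
have mI : measurable (`[0, t]%classic : set (measurableTypeR R)) by exact: measurable_itv.
apply: (eq_integrable mI ((EFin \o f) \_ D \o (pair^~ w))).
  move=> s; rewrite inE/= in_itv/= => /andP[s0 st]; rewrite patchE mem_set//.
  by split=> //=; rewrite in_itv/= s0 (le_trans st).
exact: integrableS h.
Qed.

Lemma kernel_square_integrable (W : R -> {RV P >-> R}) (k : R -> space ->
    R) (t : R) : kernel_L2 T W k ->
  0 <= t <= T -> square_integrable (space_time P) D (k t).
Proof.
move=> [[mk _] [M kM]] t0; split; last by apply: le_lt_trans (kM t t0) _; rewrite ltry.
have mI : measurable (`[0, T]%classic : set (measurableTypeR R)) by exact: measurable_itv.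
apply: (measurable_comp (F := `[0, T] `*` D) (f := fun z => k z.1 z.2) (g := pair t)) => //.
- exact: measurableX.
- by move=> _ [z Dz <-]; split=> //=; rewrite in_itv.
- apply: measurable_funTS; exact: pair1_measurable.
Qed.

End SpaceTime.

(** * From the integral equation to an operator equation *)

Section StateEquation.
Context d (Omega : measurableType d) (R : realType) (P : probability Omega R).
Context (T : R) (T_gt0 : 0 < T) (W : R -> {RV P >-> R}) (W_brownian : brownian_motion T W).
Context (g : game R Omega) (g_H1 : H1 T W g).
Context (o : state_operators T W) (o_game : operators_of_game g o).

Local Notation HF := (L2F T W).
Local Notation HO := (L2Omega T W).
Local Notation mu := (@lebesgue_measure R).
Local Notation space := (measurableTypeR R * Omega)%type.

Let mD : measurable (time_domain (Omega := Omega) T) := measurable_time_domain (Omega := Omega) T.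

Let path_integrable (k : R -> space -> R) (X : HF) t : kernel_L2 T W k -> 0 <= t <= T ->
  {ae P, forall w, mu.-integrable `[0, t] (fun s => (k t (s, w) * L2val X (s, w))%:E)}.
Proof.
move=> kL t0; have /andP[t0' tT] := t0.
have := mul_integrable mD (kernel_square_integrable kL t0) (L2val_square_integrable X).
by move=> /(integrable_path t0' tT).
Qed.

(** The sum of the three given Ito integrals is a version of the integral of the diffusion.
    Uniqueness compares any other version with it; conversely it serves as the witness. *)
Lemma ito_value_state (X u1 u2 : HF) (t : R) (y0 yA yB yC y : Omega -> R) :
  0 <= t <= T ->
  volterra_at (kA1 g) (kA2 g) X t yA -> volterra_at (kB1 g) (kB2 g) u1 t yB ->
  volterra_at (kC1 g) (kC2 g) u2 t yC ->
  ito_value W t y0 (drift g X u1 u2 t) (diffusion g X u1 u2 t) y <->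
  {ae P, forall w, y w = y0 w + yA w + yB w + yC w}.
Proof.
move=> t0 [IA iA eA] [IB iB eB] [IC iC eC]; have /andP[_ tT] := t0.
have [[kA kB kC] _] := g_H1.
have iS := ito_integralD (ito_integralD iA iB) iC.
have dr : {ae P, forall w, Rintegral mu `[0, t] (fun s => drift g X u1 u2 t (s, w)) =
    Rintegral mu `[0, t] (fun s => kA1 g t (s, w) * L2val X (s, w)) +
    Rintegral mu `[0, t] (fun s => kB1 g t (s, w) * L2val u1 (s, w)) +
    Rintegral mu `[0, t] (fun s => kC1 g t (s, w) * L2val u2 (s, w))}.
  have := path_integrable X kA t0; have := path_integrable u2 kC t0.
  have := path_integrable u1 kB t0; apply: filterS3 => w hB hC hA.
  have mI : measurable (`[0, t]%classic : set (measurableTypeR R)) by exact: measurable_itv.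
  have hAB : mu.-integrable `[0, t] (fun s => (kA1 g t (s, w) * L2val X (s, w) +
      kB1 g t (s, w) * L2val u1 (s, w))%:E) by exact: (integrableD mI hA hB).
  by rewrite /drift (RintegralD mI hAB hC) (RintegralD mI hA hB).
have sum : {ae P, forall w, y0 w + Rintegral mu `[0, t] (fun s => drift g X u1 u2 t (s, w)) +
    (IA w + IB w + IC w) = y0 w + yA w + yB w + yC w}.
  by near=> w; rewrite (near eA w)// (near eB w)// (near eC w)// (near dr w)//; ring.
split=> [[I iI eI]|h].
  have II := ito_integral_unique W_brownian tT iI iS.
  by move: II eI sum; apply: filterS3 => w II eI <-; rewrite eI II.
exists (fun w => IA w + IB w + IC w) => //.
by move: h sum; apply: filterS2 => w -> <-.
Unshelve. all: by end_near.
Qed.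

Context (phi : R * Omega -> R).
Context (phi_L2 : phi \in L2fun (space_time P) (time_domain T) (adapted_fun T W)).
Context (phiT_L2 : (fun w => phi (T, w)) \in L2fun P setT (final_measurable T W)).

Local Notation Phi := (L2class (measurable_time_domain T) phi_L2 : HF).
Local Notation PhiT := (L2class measurableT phiT_L2 : HO).

Lemma is_stateP (u : (HF * HF)%type) (p : (HF * HO)%type) : is_state g phi u p <->
  p.1 = Phi + opA o p.1 + opU o u /\ p.2 = PhiT + Delta_T o p.1 + Gamma_T o u.
Proof.
have [[vA vB vC] [tA tB tC]] := o_game.
have T0 : 0 <= T <= T by rewrite lexx ltW.
have [mphi _] := L2fun_square_integrable phi_L2.
have mL (x : HF) : measurable_fun (time_domain T) (L2val x) by case: (L2val_square_integrable x).
rewrite /is_state /opU /Gamma_T.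
have st : {ae mu, forall t : R, 0 <= t <= T ->
    (ito_value W t (fun w => phi (t, w)) (drift g p.1 u.1 u.2 t)
      (diffusion g p.1 u.1 u.2 t) (fun w => L2val p.1 (t, w))) <->
    {ae P, forall w, L2val p.1 (t, w) = phi (t, w) + L2val (opA o p.1) (t, w) +
      L2val (opB o u.1) (t, w) + L2val (opC o u.2) (t, w)}}.
  have := vA p.1; have := vB u.1; have := vC u.2.
  apply: (filterS3 (F := almost_everywhere mu)) => t hC hB hA t0.
  by apply: ito_value_state => //; [exact: hA|exact: hB|exact: hC].
have stT := ito_value_state (fun w => phi (T, w)) (L2val p.2) T0 (tA p.1) (tB u.1) (tC u.2).
have e1 : {ae mu, forall t : R, 0 <= t <= T ->
    {ae P, forall w, L2val p.1 (t, w) = phi (t, w) + L2val (opA o p.1) (t, w) +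
      L2val (opB o u.1) (t, w) + L2val (opC o u.2) (t, w)}} <->
    p.1 = Phi + opA o p.1 + (opB o u.1 + opC o u.2).
  have := @ae_space_time_eq _ _ _ P T (L2val p.1) (fun z => phi z + L2val (opA o p.1) z +
      L2val (opB o u.1) z + L2val (opC o u.2) z) (mL _).
  move=> <-; last by do 3 apply: measurable_funD => //.
  have vS : {ae space_time P, forall z, time_domain T z ->
      L2val (Phi + opA o p.1 + (opB o u.1 + opC o u.2)) z = phi z + L2val (opA o p.1) z +
      L2val (opB o u.1) z + L2val (opC o u.2) z}.
    have h1 := L2valD (Phi + opA o p.1) (opB o u.1 + opC o u.2).
    have h2 := L2valD Phi (opA o p.1); have h3 := L2valD (opB o u.1) (opC o u.2).
    have h4 := L2val_class mD phi_L2.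
    near=> z => Dz.
    rewrite (near h1 z)// (near h2 z)// (near h3 z)// (near h4 z)// addrA//.
  split=> [h|e]; last by rewrite -e in vS.
  by apply: L2space_eq; move: h vS; apply: filterS2 => z h k Dz; rewrite h// k.
have e2 : {ae P, forall w, L2val p.2 w = phi (T, w) + L2val (Delta_T o p.1) w +
      L2val (Lambda_T o u.1) w + L2val (Pi_T o u.2) w} <->
    p.2 = PhiT + Delta_T o p.1 + (Lambda_T o u.1 + Pi_T o u.2).
  have vS : {ae P, forall w,
      L2val (PhiT + Delta_T o p.1 + (Lambda_T o u.1 + Pi_T o u.2)) w = phi (T, w) +
      L2val (Delta_T o p.1) w + L2val (Lambda_T o u.1) w + L2val (Pi_T o u.2) w}.
    have h1 := L2valD (PhiT + Delta_T o p.1) (Lambda_T o u.1 + Pi_T o u.2).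
    have h2 := L2valD PhiT (Delta_T o p.1); have h3 := L2valD (Lambda_T o u.1) (Pi_T o u.2).
    have h4 := L2val_class measurableT phiT_L2.
    near=> z.
    rewrite (near h1 z)// (near h2 z)// (near h3 z)// (near h4 z)// addrA//.
  split=> [h|e]; last by rewrite -e in vS.
  by apply: L2space_eq; move: h vS; apply: filterS2 => z h k _; rewrite h// k.
rewrite -e1 -e2 -stT.
have -> : {ae mu, forall t : R, 0 <= t <= T ->
    (ito_value W t (fun w => phi (t, w)) (drift g p.1 u.1 u.2 t)
      (diffusion g p.1 u.1 u.2 t) (fun w => L2val p.1 (t, w)))} <->
  {ae mu, forall t : R, 0 <= t <= T ->
    {ae P, forall w, L2val p.1 (t, w) = phi (t, w) + L2val (opA o p.1) (t, w) +
      L2val (opB o u.1) (t, w) + L2val (opC o u.2) (t, w)}}.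
  by split; move: st; apply: (filterS2 (F := almost_everywhere mu)) => t st h t0; apply/(st t0);
      exact: h.
by [].
Unshelve. all: by end_near.
Qed.

End StateEquation.

(** * The cost as a quadratic functional *)

Section FilteredSpaces.
Context d (Omega : measurableType d) (R : realType) (P : probability Omega R).
Context (T : R) (W : R -> {RV P >-> R}).

Let measurable_wrt_limsup s (f : nat -> Omega -> R) :
  (forall n, measurable_wrt (natural_filtration W s) (f n)) ->
  measurable_wrt (natural_filtration W s) (fun w => fine (limn_esup (fun n => (f n w)%:E))).
Proof.
move=> mf; apply/measurable_wrtP; apply: measurableT_comp; first exact: fine_measurable.
apply: measurable_fun_limn_esup => n; apply/measurable_EFinP; exact/measurable_wrtP.
Qed.

(** The limit formula acts at each fixed time, so adaptedness survives at every time of [0, T]. *)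
Lemma L2F_hilbert : hilbert (L2F T W).
Proof.
apply: L2space_hilbert => f fS; apply/asboolP => s sT.
by apply: (@measurable_wrt_limsup _ (fun n w => f n (s, w))) => n; have /asboolP := fS n; apply.
Qed.

Lemma L2Omega_hilbert : hilbert (L2Omega T W).
Proof.
apply: L2space_hilbert => f fS; apply/asboolP.
by apply: measurable_wrt_limsup => n; have /asboolP := fS n.
Qed.

End FilteredSpaces.

Section BoundedFunctionals.
Context (R : realType) (U V : innerProductType R).

Lemma bounded_functionalD (f g : U -> R) : bounded_functional f -> bounded_functional g ->
  bounded_functional (fun x => f x + g x).
Proof.
move=> [fl [C C0 fC]] [gl [E E0 gE]]; split=> [a x y|]; first by rewrite fl gl; ring.
exists (2 * C + 2 * E) => [|x]; first by rewrite addr_ge0// mulr_ge0.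
by have := sqr_ge0 (f x - g x); have := fC x; have := gE x; nra.
Qed.

Lemma bounded_functionalZ (k : R) (f : U -> R) : bounded_functional f ->
  bounded_functional (fun x => k * f x).
Proof.
move=> [fl [C C0 fC]]; split=> [a x y|]; first by rewrite fl; ring.
exists (k ^+ 2 * C) => [|x]; first by rewrite mulr_ge0// sqr_ge0.
by rewrite exprMn -[leRHS]mulrA ler_wpM2l ?sqr_ge0.
Qed.

Lemma bounded_functional_fst (f : U -> R) : bounded_functional f ->
  bounded_functional (fun x : (U * V)%type => f x.1).
Proof.
move=> [fl [C C0 fC]]; split=> [a x y|]; first exact: fl.
exists C => // x; apply: le_trans (fC _) _.
by rewrite ler_wpM2l// dotp_pairE lerDl dotp_ge0.
Qed.

Lemma bounded_functional_snd (f : V -> R) : bounded_functional f ->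
  bounded_functional (fun x : (U * V)%type => f x.2).
Proof.
move=> [fl [C C0 fC]]; split=> [a x y|]; first exact: fl.
exists C => // x; apply: le_trans (fC _) _.
by rewrite ler_wpM2l// dotp_pairE lerDr dotp_ge0.
Qed.

End BoundedFunctionals.

(** * Bilinear forms with a bounded weight *)

Section WeightedForm.
Context d (X : measurableType d) (R : realType) (mu : {measure set X -> \bar R}).
Context (D : set X) (mD : measurable D) (S : submodClosed (X -> R)).
Context (h : X -> R) (mh : measurable_fun D h) (M : R) (hM : forall z, D z -> `|h z| <= M).
Local Notation E := (L2space mu mD S).

Definition weighted_form (x y : E) : R :=
  Rintegral mu D (fun z => h z * L2val x z * L2val y z).

Let integrableZ (k : R) (f : X -> R) : mu.-integrable D (fun z => (f z)%:E) ->
  mu.-integrable D (fun z => (k * f z)%:E).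
Proof. exact: integrableZl. Qed.

Let integrableDr (f g : X -> R) : mu.-integrable D (fun z => (f z)%:E) ->
  mu.-integrable D (fun z => (g z)%:E) -> mu.-integrable D (fun z => (f z + g z)%:E).
Proof. exact: integrableD. Qed.

Lemma weighted_form_integrable (x y : E) :
  mu.-integrable D (fun z => (h z * L2val x z * L2val y z)%:E).
Proof.
have := bounded_mul_integrable mD mh hM
  (mul_integrable mD (L2val_square_integrable x) (L2val_square_integrable y)).
by under [X in integrable _ _ X -> _]eq_fun do rewrite mulrA.
Qed.

Lemma weighted_formC (x y : E) : weighted_form x y = weighted_form y x.
Proof. by congr Rintegral; apply/funext => z; rewrite mulrAC. Qed.

Let eq_ae_Rintegral (f g : X -> R) : measurable_fun D f -> measurable_fun D g ->
  {ae mu, forall z, D z -> f z = g z} -> Rintegral mu D f = Rintegral mu D g.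
Proof.
move=> mf mg fg; rewrite /Rintegral; congr fine; apply: ae_eq_integral => //.
- exact/measurable_EFinP.
- exact/measurable_EFinP.
- by move: fg; apply: filterS => z k Dz; rewrite k.
Qed.

Lemma weighted_form_linear (x : E) (a : R) (y z : E) :
  weighted_form x (a *: y + z) = a * weighted_form x y + weighted_form x z.
Proof.
have mE u v : measurable_fun D (fun w => h w * L2val (u : E) w * L2val (v : E) w).
  by apply/measurable_EFinP; exact: measurable_int (weighted_form_integrable u v).
rewrite /weighted_form -RintegralZl//; last exact: weighted_form_integrable.
rewrite -RintegralD//; last 2 first.
- by apply: integrableZ; exact: weighted_form_integrable.
- exact: weighted_form_integrable.
apply: eq_ae_Rintegral => //.
  by apply: measurable_funD => //; apply: measurable_funM.
have h1 := L2valD (a *: y) z; have h2 := L2valZ a y.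
move: h1 h2; apply: filterS2 => w h1 h2 Dw; rewrite h1// h2//; ring.
Qed.

(** The product [h * L2val x] may fall outside [S], as when [h] is the terminal weight, so
    [Cauchy_Schwarz] in the space does not apply to it; the discriminant bound is applied to the
    integrals directly. *)
Lemma weighted_form_bounded (x : E) : bounded_functional (weighted_form x).
Proof.
split; first exact: weighted_form_linear.
pose f z := h z * L2val x z.
have mx : measurable_fun D (L2val x) by case: (L2val_square_integrable x).
have sf : square_integrable mu D f.
  split; first exact: measurable_funM.
  apply: (@le_lt_trans _ _ (\int[mu]_(z in D) ((M ^+ 2)%:E * (L2val x z ^+ 2)%:E))%E).
    apply: ge0_le_integral => //.
    - by move=> z _; rewrite lee_fin sqr_ge0.
    - by apply/measurable_EFinP; apply: measurable_funX; exact: measurable_funM.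
    - by apply: emeasurable_funM; [exact: measurable_cst|apply/measurable_EFinP;
        exact: measurable_funX].
    - move=> z Dz; rewrite -EFinM lee_fin exprMn ler_wpM2r ?sqr_ge0//.
      by rewrite -real_normK ?num_real// ler_pXn2r ?nnegrE ?hM//; apply: le_trans (hM Dz).
  rewrite ge0_integralZl//; [|by apply/measurable_EFinP; exact: measurable_funX|by move=> z _;
      rewrite lee_fin sqr_ge0|by rewrite lee_fin sqr_ge0].
  by rewrite -dotp_L2val_sqr -EFinM ltry.
exists (Rintegral mu D (fun z => f z * f z)) => [|y].
  by apply: Rintegral_ge0 => z _; exact: sqr_ge0.
apply: le_quadratic_discriminant; last exact: dotp_ge0.
move=> t; have sy := L2val_square_integrable y.
have ff := mul_integrable mD sf sf; have fy := mul_integrable mD sf sy.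
have yy := mul_integrable mD sy sy.
rewrite /weighted_form dotp_L2val -[2 * t * _]RintegralZl// -[t ^+ 2 * _]RintegralZl//.
have i1 := integrableZ (2 * t) fy; have i2 := integrableZ (t ^+ 2) yy.
have i3 := integrableDr ff i1.
rewrite -(RintegralD mD ff i1) -(RintegralD mD i3 i2).
apply: Rintegral_ge0 => z _.
have := sqr_ge0 (f z + t * L2val y z); congr (_ <= _); rewrite /f; ring.
Qed.

End WeightedForm.

Lemma inverseE (R : realType) (H : innerProductType R) (L M : H -> H) :
  cancel L M -> cancel M L -> inverse L =1 M.
Proof.
move=> LM ML x; rewrite /inverse; case: xgetP => [N _ [LN _]|/(_ M)[]//].
by rewrite -{1}(ML x) LN.
Qed.

(** * Forms of the game operators *)

Section GameOperators.
Context d (Omega : measurableType d) (R : realType) (P : probability Omega R).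
Context (T : R) (W : R -> {RV P >-> R}) (g : game R Omega) (g_weights : bounded_weights T W g).
Context (o : state_operators T W) (o_bounded : operators_bounded o).

Local Notation HF := (L2F T W).
Local Notation HO := (L2Omega T W).
Local Notation K := (inverse (I_A o)).
Local Notation U := (opU o).
Local Notation Gamma := (Gamma_T o).
Local Notation Delta := (Delta_T o).

Let mD : measurable (time_domain (Omega := Omega) T) := measurable_time_domain (Omega := Omega) T.
Let hF : hilbert HF := @L2F_hilbert _ _ _ _ T W.
Let hO : hilbert HO := @L2Omega_hilbert _ _ _ _ T W.
Let hFF : hilbert (HF * HF)%type := hilbert_pair hF hF.

Let wf (h : R * Omega -> R) : HF -> HF -> R :=
  weighted_form (mu := space_time P) (mD := mD) (S := adapted_fun T W) h.

Let wf_integrable h (x y : HF) : bounded_adapted T W h ->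
  (space_time P).-integrable (time_domain T) (fun z => (h z * L2val x z * L2val y z)%:E).
Proof.
move=> [[mh _] [M hM]]; apply: (weighted_form_integrable mh (M := M)) => -[s w] [/= + _].
by rewrite in_itv/=; exact: hM.
Qed.

Let wf_bounded h (x : HF) : bounded_adapted T W h -> bounded_functional (wf h x).
Proof.
move=> [[mh _] [M hM]]; apply: (weighted_form_bounded mh (M := M)) => -[s w] [/= + _].
by rewrite in_itv/=; exact: hM.
Qed.

Let wfC h x y : wf h x y = wf h y x.
Proof. exact: weighted_formC. Qed.

Let q (x y : HF) : R := wf (wQ g) x y.
Let s (x : HF) (u : (HF * HF)%type) : R := wf (wS1 g) x u.1 + wf (wS2 g) x u.2.
(* [R] is not assumed symmetric, hence the averages. *)
Let r (u v : (HF * HF)%type) : R :=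
  wf (wR11 g) u.1 v.1 + 2^-1 * (wf (wR12 g) u.2 v.1 + wf (wR12 g) u.1 v.2) +
  (2^-1 * (wf (wR21 g) u.1 v.2 + wf (wR21 g) u.2 v.1) + wf (wR22 g) u.2 v.2).
Let G : HO -> HO -> R := formG g.

Let qC x y : q x y = q y x. Proof. exact: wfC. Qed.
Let rC u v : r u v = r v u.
Proof.
rewrite /r (wfC _ u.1 v.1) (wfC _ u.2 v.1) (wfC _ u.1 v.2) (wfC _ u.2 v.2).
by rewrite (wfC _ u.1 v.2) (wfC _ u.2 v.1); ring.
Qed.
Let GC x y : G x y = G y x.
Proof. by congr Rintegral; apply/funext => z; rewrite mulrAC. Qed.

Let formQE x : formQ g x = q x x.
Proof. by congr Rintegral; apply/funext => z; rewrite expr2 mulrA. Qed.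

Let formSE x u : formS g x u = s x u.
Proof.
have [_ [S1 S2] _ _ _] := g_weights.
by rewrite /formS /expect_time RintegralD//; exact: wf_integrable.
Qed.

Let formRE u : formR g u = r u u.
Proof.
have [_ _ [R11 R12] [R21 R22] _] := g_weights.
rewrite /formR /expect_time.
have -> : (fun z => (wR11 g z * L2val u.1 z + wR12 g z * L2val u.2 z) * L2val u.1 z +
      (wR21 g z * L2val u.1 z + wR22 g z * L2val u.2 z) * L2val u.2 z) =
    (fun z => (wR11 g z * L2val u.1 z * L2val u.1 z + wR12 g z * L2val u.2 z * L2val u.1 z) +
      (wR21 g z * L2val u.1 z * L2val u.2 z + wR22 g z * L2val u.2 z * L2val u.2 z)).
  by apply/funext => z; ring.
have i11 := wf_integrable u.1 u.1 R11; have i12 := wf_integrable u.2 u.1 R12.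
have i21 := wf_integrable u.1 u.2 R21; have i22 := wf_integrable u.2 u.2 R22.
rewrite (RintegralD mD (integrableD mD i11 i12) (integrableD mD i21 i22)).
rewrite (RintegralD mD i11 i12) (RintegralD mD i21 i22).
rewrite -!/(weighted_form _ _ _) -!/(wf _ _ _) /r.
by rewrite (wfC (wR12 g) u.1 u.2) (wfC (wR21 g) u.2 u.1); field.
Qed.

Let G_bounded x : bounded_functional (G x).
Proof.
have [_ _ _ _ [mG [M GM]]] := g_weights.
exact: (weighted_form_bounded (S := final_measurable T W) (mD := measurableT) mG (fun w _ => GM w)).
Qed.

Let GDr x y z : G x (y + z) = G x y + G x z.
Proof. by have [/(_ 1 y z) + _] := G_bounded x; rewrite scale1r mul1r. Qed.

Let GD x y z : G (x + y) z = G x z + G y z.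
Proof. by rewrite GC GDr !(GC z). Qed.

Let GDD a b c e : G (a + b) (c + e) = G a c + G a e + G b c + G b e.
Proof. by rewrite GD !GDr; ring. Qed.

Let s_bounded x : bounded_functional (s x).
Proof.
have [_ [S1 S2] _ _ _] := g_weights.
apply: bounded_functionalD; first exact: bounded_functional_fst (wf_bounded x S1).
exact: bounded_functional_snd (wf_bounded x S2).
Qed.

Let s_bounded' u : bounded_functional (s^~ u).
Proof.
have [_ [S1 S2] _ _ _] := g_weights.
rewrite (_ : s^~ u = fun x => wf (wS1 g) u.1 x + wf (wS2 g) u.2 x).
  by apply: bounded_functionalD; exact: wf_bounded.
by apply/funext => x; rewrite /s wfC (wfC (wS2 g)).
Qed.

Let r_bounded u : bounded_functional (r u).
Proof.
have [_ _ [R11 R12] [R21 R22] _] := g_weights.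
apply: bounded_functionalD; apply: bounded_functionalD.
- exact: bounded_functional_fst (wf_bounded _ R11).
- apply: bounded_functionalZ; apply: bounded_functionalD.
    exact: bounded_functional_fst (wf_bounded _ R12).
  exact: bounded_functional_snd (wf_bounded _ R12).
- apply: bounded_functionalZ; apply: bounded_functionalD.
    exact: bounded_functional_snd (wf_bounded _ R21).
  exact: bounded_functional_fst (wf_bounded _ R21).
- exact: bounded_functional_snd (wf_bounded _ R22).
Qed.

Let dotp_opQ x y : dotp (opQ g x) y = q x y.
Proof.
have [wq _ _ _ _] := g_weights.
rewrite /opQ (_ : formQ g = fun x => q x x); last by apply/funext => z; exact: formQE.
by apply: operator_of_quadraticP => // z; exact: wf_bounded.
Qed.

Let dotp_opR u v : dotp (opR g u) v = r u v.
Proof.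
rewrite /opR (_ : formR g = fun x => r x x); last by apply/funext => z; exact: formRE.
exact: operator_of_quadraticP.
Qed.

Let dotp_opS x u : dotp (opS g x) u = s x u.
Proof.
rewrite /opS (_ : formS g = s); last by apply/funext => z; apply/funext => v; exact: formSE.
exact: operator_of_formP.
Qed.

Let dotp_opG x y : dotp (opG g x) y = G x y.
Proof. exact: operator_of_formP. Qed.

Let adjA : forall x y, dotp (opA o x) y = dotp x (adjoint (opA o) y).
Proof. by have [[bA _ _] _] := o_bounded; exact: adjointP. Qed.

Let adjDelta : forall x y, dotp (Delta x) y = dotp x (adjoint Delta y).
Proof. by have [_ [[bD _ _] _]] := o_bounded; exact: adjointP. Qed.

Let adjU : forall x y, dotp (U x) y = dotp x (adjoint U y).
Proof.
have [[_ bB bC] _] := o_bounded.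
apply: (@adjoint_ext _ _ _ _ (fun y => (adjoint (opB o) y, adjoint (opC o) y))) => x y.
by rewrite dotp_pairE/= dotpDl (adjointP hF bB) (adjointP hF bC).
Qed.

Let adjGamma : forall x y, dotp (Gamma x) y = dotp x (adjoint Gamma y).
Proof.
have [_ [[_ bB bC] _]] := o_bounded.
apply: (@adjoint_ext _ _ _ _ (fun y => (adjoint (Lambda_T o) y, adjoint (Pi_T o) y))) => x y.
by rewrite dotp_pairE/= dotpDl (adjointP hF bB) (adjointP hF bC).
Qed.

Let dotp_Q' x y : dotp (opQ' g o x) y = q x y + G (Delta x) (Delta y).
Proof. by rewrite dotpDl dotp_opQ dotpC -adjDelta dotpC dotp_opG. Qed.

Let dotp_S' x u : dotp (opS' g o x) u = s x u + G (Delta x) (Gamma u).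
Proof. by rewrite dotpDl dotp_opS dotpC -adjGamma dotpC dotp_opG. Qed.

Let dotp_R' u v : dotp (opR' g o u) v = r u v + G (Gamma u) (Gamma v).
Proof. by rewrite dotpDl dotp_opR dotpC -adjGamma dotpC dotp_opG. Qed.

Let adjS' : forall x y, dotp (opS' g o x) y = dotp x (adjoint (opS' g o) y).
Proof.
(* The candidate adjoint of [opS'] is the adjoint of [opS], by the Riesz theorem in the first
   argument of [s], plus the term through [opG], which is symmetric. *)
have /choice[St StP] : forall u, exists m, forall x, s x u = dotp m x.
  by move=> u; exact: (@riesz _ _ (s^~ u)).
apply: (@adjoint_ext _ _ _ _ (fun u => St u + adjoint Delta (opG g (Gamma u)))) => x u.
by rewrite dotp_S' StP dotpDr -adjDelta [dotp (Delta x) _]dotpC dotp_opG GC dotpC.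
Qed.

Let K_add x y : K (x + y) = K x + K y.
Proof.
have [_ [_ [M [[Ml _] LM ML]]]] := o_bounded; have KM := inverseE LM ML.
by have := Ml 1 x y; rewrite !KM !scale1r.
Qed.

Let Delta_add x y : Delta (x + y) = Delta x + Delta y.
Proof. by have [_ [[[Dl _] _ _] _]] := o_bounded; have := Dl 1 x y; rewrite !scale1r. Qed.

Let q_add x y : q (x + y) (x + y) = q x x + 2 * q x y + q y y.
Proof.
have [wq _ _ _ _] := g_weights.
have ql a b c : q a (b + c) = q a b + q a c.
  by have [/(_ 1 b c) + _] := wf_bounded a wq; rewrite scale1r mul1r.
by rewrite ql (qC _ x) (qC _ y) !ql (qC y x); ring.
Qed.

Let s_add x y u : s (x + y) u = s x u + s y u.
Proof. by have [/(_ 1 x y) + _] := s_bounded' u; rewrite scale1r mul1r. Qed.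

Let K_cancel : cancel (I_A o) K /\ cancel K (I_A o).
Proof.
have [_ [_ [M [_ LM ML]]]] := o_bounded; have KM := inverseE LM ML.
by split=> x; rewrite KM.
Qed.

(** The adjoint of a bounded inverse of [I_A] is a two-sided inverse of [I_Astar], hence is the
    chosen one. *)
Let dotp_inverse_Astar x y : dotp (inverse (I_Astar o) x) y = dotp x (K y).
Proof.
have [_ [_ [M [bM LM ML]]]] := o_bounded; have KM := inverseE LM ML.
have aM := adjointP hF bM.
have adjI u v : dotp (I_Astar o u) v = dotp u (I_A o v).
  by rewrite /I_Astar /I_A dotpBl dotpBr [dotp (adjoint _ _) _]dotpC -adjA [dotp (opA o v) _]dotpC.
rewrite KM [RHS]dotpC aM dotpC; congr dotp.
apply: inverseE => z; apply: dotp_inj => v.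
  by rewrite dotpC -aM dotpC adjI ML.
by rewrite adjI dotpC -aM dotpC LM.
Qed.

Let dotp_Ustar x v : dotp (opUstar o x) v = dotp x (K (U v)).
Proof. by rewrite /opUstar dotpC -adjU dotpC dotp_inverse_Astar. Qed.

Let dotp_V x v : dotp (opV g o x) v =
  q (K x) (K (U v)) + G (Delta (K x)) (Delta (K (U v))) +
  (s (K x) v + G (Delta (K x)) (Gamma v)).
Proof. by rewrite dotpDl dotp_Ustar dotp_Q' dotp_S'. Qed.

(** The polar form of the cost with zero [phi]: the state is [K (U u)] and its terminal value
    [Delta (K (U u)) + Gamma u]. Symmetry is visible, the two [s] terms being exchanged. *)
Let dotp_Theta u v : dotp (Theta g o u) v =
  q (K (U u)) (K (U v)) + s (K (U u)) v + s (K (U v)) u + r u v +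
  G (Delta (K (U u)) + Gamma u) (Delta (K (U v)) + Gamma v).
Proof.
rewrite /Theta 2!dotpDl dotp_V dotp_Ustar [dotp (adjoint _ _) _]dotpC -adjS' dotp_S' dotp_R'.
rewrite (GDD (Delta (K (U u))) (Gamma u)) (GC (Gamma u) (Delta (K (U v)))); ring.
Qed.

Lemma Theta_symmetric : symmetric_operator (Theta g o).
Proof.
move=> u v; rewrite [RHS]dotpC !dotp_Theta qC rC GC; ring.
Qed.

(** The cross term between the uncontrolled state [K phi] and the response to [v]. *)
Let dotp_Theta1 (phi : HF) (phiT : HO) v : dotp (Theta1 g o phi phiT) v =
  q (K phi) (K (U v)) + s (K phi) v +
  G (Delta (K phi) + phiT) (Delta (K (U v)) + Gamma v).
Proof.
rewrite /Theta1 2!dotpDl dotp_V dotp_Ustar dotpC -adjDelta dotpC dotp_opG.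
rewrite [dotp (adjoint Gamma _) _]dotpC -adjGamma [dotp (Gamma v) _]dotpC dotp_opG.
rewrite (GDD (Delta (K phi)) phiT); ring.
Qed.

Context (T_gt0 : 0 < T) (W_brownian : brownian_motion T W) (g_H1 : H1 T W g).
Context (o_game : operators_of_game g o) (phi : R * Omega -> R).
Context (phi_L2 : phi \in L2fun (space_time P) (time_domain T) (adapted_fun T W)).
Context (phiT_L2 : (fun w => phi (T, w)) \in L2fun P setT (final_measurable T W)).

Local Notation Phi := (L2class (measurable_time_domain T) phi_L2 : HF).
Local Notation PhiT := (L2class measurableT phiT_L2 : HO).

(** The state and its terminal value are affine in [u], so the forms expand exactly; the constant is
    the cost of the zero control. *)
Lemma cost_quadratic u : cost g phi u =
  (q (K Phi) (K Phi) + G (Delta (K Phi) + PhiT) (Delta (K Phi) + PhiT)) +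
  2 * dotp (Theta1 g o Phi PhiT) u + dotp (Theta g o u) u.
Proof.
pose X := K (Phi + U u); pose XT : HO := PhiT + Delta X + Gamma u.
(* [cost] evaluates a chosen state; the choice is determined only because the set of states is a
   singleton. *)
have stateE : [set p | is_state g phi u p] = [set (X, XT)].
  apply/seteqP; split=> [[X' XT']|_ ->].
    move=> /(is_stateP T_gt0 W_brownian g_H1 o_game phi_L2 phiT_L2)/= [e ->].
    suff -> : X' = X by [].
    rewrite /X -[LHS]K_cancel.1; congr K.
    by rewrite /I_A {1}e addrAC addrK.
  apply/(is_stateP T_gt0 W_brownian g_H1 o_game phi_L2 phiT_L2); split=> //=.
  have := K_cancel.2 (Phi + U u); rewrite -/X /I_A => /eqP.
  by rewrite subr_eq addrAC => /eqP.
have -> : cost g phi u = q X X + 2 * s X u + r u u + G XT XT.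
  have pE : xget (0, 0) [set p | is_state g phi u p] = (X, XT).
    by rewrite stateE; case: xgetP => [p _ //|/(_ (X, XT))[]].
  rewrite /cost pE/= -formQE -formSE -formRE; congr (_ + _); last first.
    by congr Rintegral; apply/funext => w; rewrite expr2 mulrA.
  have [wq [S1 S2] [R11 R12] [R21 R22] _] := g_weights.
  have iQ : (space_time P).-integrable (time_domain T)
      (fun z => (wQ g z * L2val X z ^+ 2)%:E).
    by under eq_fun do rewrite expr2 mulrA; exact: wf_integrable.
  have iS := integrableD mD (wf_integrable X u.1 S1) (wf_integrable X u.2 S2).
  have iR : (space_time P).-integrable (time_domain T) (fun z =>
      ((wR11 g z * L2val u.1 z + wR12 g z * L2val u.2 z) * L2val u.1 z +
      (wR21 g z * L2val u.1 z + wR22 g z * L2val u.2 z) * L2val u.2 z)%:E).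
    under eq_fun do rewrite !mulrDl.
    exact: (integrableD mD
      (integrableD mD (wf_integrable u.1 u.1 R11) (wf_integrable u.2 u.1 R12))
      (integrableD mD (wf_integrable u.1 u.2 R21) (wf_integrable u.2 u.2 R22))).
  have i2S := integrableZl mD 2 iS.
  rewrite /formQ /formS /formR /expect_time -RintegralZl//.
  rewrite -(RintegralD mD iQ i2S) -(RintegralD mD (integrableD mD iQ i2S) iR).
  by congr Rintegral; apply/funext => z; congr (_ + _ + _); ring.
have XE : X = K Phi + K (U u) by exact: K_add.
have XTE : XT = (Delta (K Phi) + PhiT) + (Delta (K (U u)) + Gamma u).
  by rewrite /XT XE Delta_add [PhiT + _]addrC -!addrA; congr (_ + _); rewrite addrCA.
rewrite dotp_Theta dotp_Theta1 XTE XE q_add s_add GDD.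
rewrite (GC (Delta (K (U u)) + Gamma u) (Delta (K Phi) + PhiT)); ring.
Qed.

End GameOperators.

Theorem theorem3p1 (d : measure_display) (Omega : measurableType d)
    (R : realType) (P : probability Omega R)
    (T : R) (T_gt0 : 0 < T)
    (W : R -> {RV P >-> R}) (W_brownian : brownian_motion T W)
    (g : game R Omega) (g_H1 : H1 T W g) (g_weights : bounded_weights T W g)
    (o : state_operators T W) (o_game : operators_of_game g o)
    (o_bounded : operators_bounded o)
    (phi : R * Omega -> R)
    (phi_L2 : phi \in L2fun (space_time P) (time_domain T) (adapted_fun T W))
    (phiT_L2 : (fun w => phi (T, w)) \in
       L2fun P setT (final_measurable T W)) :
  let saddle := saddle_point g phi in
  let Th := Theta g o in
  let Th1phi := Theta1 g o
    (L2class (measurable_time_domain T) phi_L2 : L2F T W)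
    (L2class measurableT phiT_L2 : L2Omega T W) in
  [/\ (exists u, saddle u) <->
        [/\ forall w, 0 <= dotp (Theta11 g o w) w,
            forall w, dotp (Theta22 g o w) w <= 0 &
            range Th Th1phi],
      forall u, saddle u ->
        Th u + Th1phi = 0 /\
        exists v, u = - pseudo_inverse Th Th1phi + (v - pseudo_inverse Th (Th v)) &
      (exists u, saddle u) ->
        ((exists! u, saddle u) <-> null_space Th = [set 0]) ].
Proof.
have J := cost_quadratic g_weights o_bounded T_gt0 W_brownian g_H1 o_game phi_L2 phiT_L2.
exact: (quadratic_game (Theta_symmetric g_weights o_bounded) J).
Qed.
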